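(* Let $\mu$ be a probability measure on $\mathbb{R}^d$ that is absolutely continuous with respect to Lebesgue measure, let $t>0$, and let $\eta$ be a Poisson point process on $\mathbb{R}^d$ with intensity measure $t\mu$. Let $\Pi_t$ be the convex hull of the points of $\eta$, and let $I(\Pi_t)$ be the number of points of $\eta$ lying in the interior of $\Pi_t$. Let $\kappa_k(\mu(\Pi_t))$ and $\kappa_k(I(\Pi_t))$ denote the $k$-th cumulants of the random variables $\mu(\Pi_t)$ and $I(\Pi_t)$. Then for every $k\in\mathbb{N}$, $$t^k\kappa_k(\mu(\Pi_t))=\sum_{j=1}^k \begin{bmatrix} k\\ j\end{bmatrix}\kappa_j(I(\Pi_t)).$$
   Context: The cumulants $\kappa_k(X)$ of a random variable $X$ are defined by $\ln \mathbb{E}\, e^{zX}=\sum_{k\ge1}\kappa_k(X)\frac{z^k}{k!}$. The (signed) Stirling numbers of the first kind $\begin{bmatrix} n\\ k\end{bmatrix}$ are defined by $z(z-1)\cdots(z-n+1)=\sum_{k=1}^n \begin{bmatrix} n\\ k\end{bmatrix} z^k$; equivalently $\frac{\ln^j(z+1)}{j!}=\sum_{k\ge j}\begin{bmatrix} k\\ j\end{bmatrix}\frac{z^k}{k!}$. A Poisson point process $\eta$ with intensity measure $t\mu$ is a random finite simple counting measure such that $\eta(A)$ is Poisson distributed with parameter $t\mu(A)$ and counts of disjoint sets are independent. *)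

(* Defs.v *)
From HB Require Import structures.
From mathcomp Require Import all_boot all_order all_algebra.
From mathcomp Require Import all_classical all_reals all_analysis.
Set Implicit Arguments.
Unset Strict Implicit.
Unset Printing Implicit Defensive.
Import Order.TTheory GRing.Theory Num.Theory.
Import numFieldTopology.Exports numFieldNormedType.Exports.
Local Open Scope classical_set_scope.
Local Open Scope ring_scope.

Definition Rd (R : realType) (d : nat) := g_sigma_algebraType (@open 'M[R]_(1, d)).

Definition box (R : realType) (d : nat) (a b : 'rV[R]_d) : set 'rV[R]_d :=
  [set x | forall i : 'I_d, a ord0 i <= x ord0 i <= b ord0 i].
Definition boxvol (R : realType) (d : nat) (a b : 'rV[R]_d) : R :=
  \prod_(i < d) Num.max (b ord0 i - a ord0 i) 0.

Definition lebesgue_null (R : realType) (d : nat) (A : set 'rV[R]_d) : Prop :=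
  forall eps : R, 0 < eps -> exists a b : nat -> 'rV[R]_d,
    A `<=` \bigcup_n box (a n) (b n) /\
    forall N : nat, \sum_(n < N) boxvol (a n) (b n) <= eps.

Definition abs_cont_leb (R : realType) (d : nat) (mu : probability (Rd R d) R) :=
  forall A : set (Rd R d), measurable A -> lebesgue_null A -> mu A = 0%E.

Definition count_in (R : realType) (d : nat) (s : seq 'rV[R]_d) (A : set 'rV[R]_d) : nat :=
  count (fun x => x \in A) s.

Definition poisson_mass (R : realType) (r : R) (n : nat) : R :=
  r ^+ n / (n`!)%:R * expR (- r).

(* eta is a Poisson point process on R^d with intensity measure t * mu,
   defined on the probability space (T, P): a random finite simple counting
   measure (represented by the duplicate-free list of its atoms) whose counts
   of Borel sets are random variables, Poisson distributed with parameter
   t mu(A), and independent for pairwise disjoint Borel sets. *)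
Definition poisson_pp (R : realType) (d : nat) (dT : measure_display)
  (T : measurableType dT) (P : probability T R) (t : R)
  (mu : probability (Rd R d) R) (eta : T -> seq 'rV[R]_d) : Prop :=
  [/\ (forall w, uniq (eta w)),
      (forall (A : set (Rd R d)), measurable A -> forall n : nat,
         measurable [set w | count_in (eta w) A = n]),
      (forall (A : set (Rd R d)), measurable A -> forall n : nat,
         P [set w | count_in (eta w) A = n] = (poisson_mass (t * fine (mu A)) n)%:E) &
      (forall (m : nat) (A : 'I_m -> set (Rd R d)),
         (forall i, measurable (A i)) ->
         (forall i j, i != j -> A i `&` A j = set0) ->
         forall n : 'I_m -> nat,
         fine (P (\bigcap_i [set w | count_in (eta w) (A i) = n i])) =
         \prod_(i < m) fine (P [set w | count_in (eta w) (A i) = n i]))].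

Definition conv_hull (R : realType) (d : nat) (s : seq 'rV[R]_d) : set 'rV[R]_d :=
  [set x | exists w : 'I_(size s) -> R,
     [/\ (forall i, 0 <= w i), \sum_(i < size s) w i = 1 &
         x = \sum_(i < size s) w i *: s`_i]].

Definition interior_count (R : realType) (d : nat) (s : seq 'rV[R]_d) : nat :=
  count_in s (interior (conv_hull s : set 'M[R]_(1, d))).

(* kappa is the sequence of cumulants of the real random variable X:
   ln E e^{zX} = sum_{k>=1} kappa_k z^k / k!  for z in a neighbourhood of 0
   (kappa 0 is irrelevant). *)
Definition is_cumulant_seq (R : realType) (dT : measure_display)
  (T : measurableType dT) (P : probability T R) (X : T -> R) (kappa : nat -> R) : Prop :=
  measurable_fun setT X /\
  exists r : R, 0 < r /\ forall z : R, `|z| < r ->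
    P.-integrable setT (fun w => (expR (z * X w))%:E) /\
    (fun n : nat => \sum_(1 <= k < n) kappa k * z ^+ k / (k`!)%:R) @ \oo -->
      ln (fine (\int[P]_w (expR (z * X w))%:E)).

(* Signed Stirling numbers of the first kind:
   z(z-1)...(z-n+1) = sum_k stirling1 n k z^k. *)
Definition stirling1 (n k : nat) : int :=
  (\prod_(i < n) ('X - (i%:Z)%:P))`_k.

(* Main.v *)
(* The interior of the hull K of eta does not change when a point of eta interior
   to K is removed.  Hence the Mecke formula
     E sum_(x in eta) F(x, eta - x) = t E int F(x, eta) mu(dx),
   applied to F(x, s) = 1[x in int conv s] I(s)^_m (t mu(conv s))^j, reads
     E I^_(m+1) (t mu(K))^j = E I^_m (t mu(K))^(j+1),
   and so E I^_m = E (t mu(K))^m for all m: E (1+s)^I = E exp(s t mu(K)) for s >= 0.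
   The logarithms of both sides are power series in ln(1+s) and in s, and comparing
   their k-th derivatives at 0 gives the Stirling numbers.
   The Mecke formula is proved for functions of the numbers of points in finitely
   many cells, where it is the identity (n+1) p(n+1) = r p(n) of the Poisson
   weights; F is an increasing limit of such functions because "x in int conv s"
   is an open condition. *)
Require Import Defs.
From HB Require Import structures.
From mathcomp Require Import all_boot all_order all_algebra.
From mathcomp Require Import all_classical all_reals all_analysis.
From mathcomp Require Import measurable_realfun ring lra zify.
Import Order.TTheory GRing.Theory Num.Theory.
Import numFieldTopology.Exports numFieldNormedType.Exports.
Local Open Scope classical_set_scope.
Local Open Scope ring_scope.

Set Implicit Arguments.
Unset Strict Implicit.
Unset Printing Implicit Defensive.

(** * Convex hulls of finite sequences *)

Section ConvexHull.
Context {R : realType} {d : nat}.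
Implicit Types (x y z : 'rV[R]_d) (s : seq 'rV[R]_d) (C : set 'rV[R]_d).

(** The Mecke step sees only the open set int K, since its limit argument needs openness; absolute
    continuity turns mu(int K) into mu(K), because the boundary of a hull lies in finitely many
    hyperplanes. Invariance under removal of an interior point fails in dimension 0, where a single
    point is open, hence d > 0. The transforms are compared for s >= 0 only: there every term of the
    expansions is nonnegative and may be exchanged with the expectation before anything is known
    about exponential moments of I. Those moments then follow from mu <= 1. The price is that the
    two logarithms are identified on one side of 0 only, so the derivatives are compared on an open
    interval to the right of 0 and reach 0 as right limits. Existence of the cumulants requires the
    logarithm of a power series to be a power series again. Its coefficients are obtained by solving
    A' = c A formally for c, and a geometric bound on c gives convergence. *)

Definition is_convex C := forall x y (l : R), 0 <= l <= 1 -> C x -> C y ->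
  C (l *: x + (1 - l) *: y).

Lemma convex_sum C n (w : 'I_n -> R) (p : 'I_n -> 'rV[R]_d) : is_convex C ->
  (forall i, 0 <= w i) -> \sum_i w i = 1 -> (forall i, C (p i)) ->
  C (\sum_i w i *: p i).
Proof.
move=> Cc; elim: n w p => [|n IH] w p w0 w1 Cp.
  by move/eqP: w1; rewrite big_ord0 eq_sym oner_eq0.
(* The inductive step renormalises the other weights by [1 - w ord0], so the case where this is 0 is
   treated apart: all other weights vanish. *)
have [e|ne] := eqVneq (w ord0) 1.
  have H i : w (lift ord0 i) = 0.
    have : \sum_(i < n) w (lift ord0 i) = 0.
      by move: w1; rewrite big_ord_recl e => /(canRL (addKr 1)); rewrite addrC subrr.
    move=> /eqP; rewrite psumr_eq0 => [/allP/(_ i)|? _]; last exact: w0.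
    by rewrite mem_index_enum => /(_ isT)/eqP.
  rewrite big_ord_recl e scale1r big1 ?addr0// => i _.
  by rewrite H scale0r.
have S : \sum_(i < n) w (lift ord0 i) = 1 - w ord0.
  by move: w1; rewrite big_ord_recl => <-; rewrite addrC addKr.
have lt1 : 0 < 1 - w ord0.
  by rewrite subr_gt0 lt_neqAle ne -subr_ge0 -S sumr_ge0.
rewrite big_ord_recl.
have -> : \sum_(i < n) w (lift ord0 i) *: p (lift ord0 i) =
  (1 - w ord0) *: \sum_(i < n) ((1 - w ord0)^-1 * w (lift ord0 i)) *: p (lift ord0 i).
  rewrite scaler_sumr; apply: eq_bigr => i _.
  by rewrite scalerA mulVKf// gt_eqF.
apply: Cc => //; first by rewrite w0 -subr_ge0 ltW.
apply: IH => [i||i //].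
- by rewrite mulr_ge0// invr_ge0 ltW.
- by rewrite -mulr_sumr S mulVf// gt_eqF.
Qed.

Lemma conv_hull_min C s : is_convex C -> (forall x, x \in s -> C x) ->
  conv_hull s `<=` C.
Proof.
move=> Cc Cs _ [w [w0 w1 ->]]; apply: convex_sum => // i.
by apply: Cs; rewrite mem_nth.
Qed.

Lemma mem_conv_hull s x : x \in s -> conv_hull s x.
Proof.
move=> xs; have i0 : (index x s < size s)%N by rewrite index_mem.
exists (fun i => (i == Ordinal i0)%:R); split.
- by move=> i; rewrite ler0n.
- rewrite (bigD1 (Ordinal i0))//= eqxx big1 ?addr0// => i /negPf ne.
  by rewrite ne.
- rewrite (bigD1 (Ordinal i0))//= eqxx scale1r nth_index// big1 ?addr0// => i.
  by move=> /negPf ->; rewrite scale0r.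
Qed.

Lemma conv_hull_convex s : is_convex (conv_hull s).
Proof.
move=> _ _ l /andP[l0 l1] [v [v0 v1 ->]] [w [w0 w1 ->]].
exists (fun i => l * v i + (1 - l) * w i); split.
- by move=> i; rewrite addr_ge0 ?mulr_ge0// subr_ge0.
- by rewrite big_split/= -!mulr_sumr v1 w1 !mulr1 addrC subrK.
- rewrite !scaler_sumr -big_split/=; apply: eq_bigr => i _.
  by rewrite !scalerA -scalerDl.
Qed.

Lemma conv_hull_sub s s' : {subset s <= s'} -> conv_hull s `<=` conv_hull s'.
Proof.
move=> ss'; apply: conv_hull_min; first exact: conv_hull_convex.
by move=> x /ss'; exact: mem_conv_hull.
Qed.

Lemma conv_hull_nil : conv_hull ([::] : seq 'rV[R]_d) = set0.
Proof.
by rewrite -subset0 => x [w [_ /eqP]]; rewrite big_ord0 eq_sym oner_eq0.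
Qed.

Lemma conv_hull1 x : conv_hull [:: x] = [set x].
Proof.
apply/seteqP; split; last by move=> _ ->; apply: mem_conv_hull; rewrite inE.
apply: conv_hull_min => [y z l _ -> ->|y]; last by rewrite inE => /eqP.
by rewrite -scalerDl addrC subrK scale1r.
Qed.

(** The points of this form are a convex set containing [x] and all entries of [s], so minimality of
    the hull applies. *)
Lemma conv_hull_cons s x y : s != [::] -> conv_hull (x :: s) y ->
  exists l c, [/\ 0 <= l <= 1, conv_hull s c & y = l *: x + (1 - l) *: c].
Proof.
case: s => [//|a s] _; move: y.
apply: (@conv_hull_min [set y | exists l c,
  [/\ 0 <= l <= 1, conv_hull (a :: s) c & y = l *: x + (1 - l) *: c]]); last first.
  move=> y; rewrite inE => /orP[/eqP ->|ys].
    exists 1, a; split; first by rewrite ler01 lexx.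
      by apply: mem_conv_hull; rewrite inE eqxx.
    by rewrite subrr scale0r addr0 scale1r.
  exists 0, y; split; first by rewrite ler01 lexx.
    exact: mem_conv_hull.
  by rewrite scale0r add0r subr0 scale1r.
move=> _ _ m /andP[m0 m1] [l1 [c1 [/andP[l10 l11] C1 ->]]]
  [l2 [c2 [/andP[l20 l21] C2 ->]]].
(* The weights that [c1] and [c2] receive in the combined point; when both vanish that point is [x]
   itself and any [c] will do. *)
pose p := m * (1 - l1); pose q := (1 - m) * (1 - l2).
have p0 : 0 <= p by rewrite mulr_ge0// subr_ge0.
have q0 : 0 <= q by rewrite mulr_ge0// subr_ge0.
have E : 1 - (m * l1 + (1 - m) * l2) = p + q by rewrite /p /q; ring.
have l0 : 0 <= m * l1 + (1 - m) * l2 by rewrite addr_ge0 ?mulr_ge0// subr_ge0.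
have lE : m *: (l1 *: x + (1 - l1) *: c1) + (1 - m) *: (l2 *: x + (1 - l2) *: c2)
  = (m * l1 + (1 - m) * l2) *: x + (p *: c1 + q *: c2).
  by rewrite !scalerDr !scalerA scalerDl addrACA.
exists (m * l1 + (1 - m) * l2).
have [pq|pq] := eqVneq (p + q) 0.
  exists c1; rewrite lE E pq scale0r l0 -subr_ge0 E pq lexx; split => //.
  move/eqP: pq; rewrite paddr_eq0// => /andP[/eqP -> /eqP ->].
  by rewrite !scale0r addr0.
have pq0 : 0 < p + q by rewrite lt0r pq addr_ge0.
exists ((p / (p + q)) *: c1 + (1 - p / (p + q)) *: c2); split.
- by rewrite l0 -subr_ge0 E ltW.
- apply: conv_hull_convex => //.
  by rewrite divr_ge0 ?(ltW pq0)//= ler_pdivrMr// mul1r lerDl.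
- rewrite lE E scalerDr !scalerA; congr (_ + (_ *: _ + _ *: _)); by field.
Qed.

(** Adding a vertex turns the hull into the continuous image of the segment [0, 1] times the
    previous hull. *)
Lemma conv_hull_compact s : compact (conv_hull s : set 'M[R]_(1, d)).
Proof.
case: s => [|a s]; first by rewrite conv_hull_nil; exact: compact0.
elim: s a => [|b s IH] a; first by rewrite conv_hull1; exact: compact_set1.
pose f (u : R * 'M[R]_(1, d)) : 'M[R]_(1, d) := u.1 *: a + (1 - u.1) *: u.2.
have -> : conv_hull (a :: b :: s) = f @` (`[0, 1] `*` conv_hull (b :: s)).
  apply/seteqP; split=> [y /conv_hull_cons[//|l [c [l01 Cc ->]]]|].
    by exists (l, c) => //; split => //=; rewrite in_itv.
  move=> _ [[l c] /= [+ Cc] <-]; rewrite in_itv/= => l01.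
  apply: conv_hull_convex => //; first by apply: mem_conv_hull; rewrite inE eqxx.
  by apply: conv_hull_sub Cc => z zs; rewrite inE zs orbT.
apply: continuous_compact; last by apply: compact_setX; [exact: segment_compact|exact: IH].
apply: continuous_subspaceT => u; rewrite /f.
apply: cvgD; first by apply: cvgZr_tmp; exact: cvg_fst.
apply: cvgZ; last exact: cvg_snd.
by apply: cvgB; [exact: cvg_cst|exact: cvg_fst].
Qed.

Lemma conv_hull_closed s : closed (conv_hull s : set 'M[R]_(1, d)).
Proof.
have h := @norm_hausdorff R (('M[R]_(1, d)) : normedModType R).
exact: compact_closed h (@conv_hull_compact s).
Qed.

End ConvexHull.

(** * Interior points of a hull: removal of a vertex and stability under perturbation *)

Section HullInterior.
Context {R : realType} {d : nat}.
Implicit Types (x y : 'rV[R]_d) (s : seq 'rV[R]_d).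

Lemma interior_normP (A : set 'M[R]_(1, d)) (x : 'M[R]_(1, d)) :
  interior A x <-> exists2 e : R, 0 < e & forall y, `|x - y| < e -> A y.
Proof.
split=> [/nbhs_ballP[e e0 eA]|[e e0 eA]].
  by exists e => // y xy; apply: eA; rewrite -ball_normE.
by apply/nbhs_ballP; exists e => // y; rewrite -ball_normE; exact: eA.
Qed.

(** Take another vertex [c] and move from [x] slightly away from [c]. The point reached is still in
    the hull, so it is a combination of [x] and some [b] in the hull of the others; solving for [x]
    puts [x] between [c] and [b]. If no other vertex is left, the hull is a single point, which has
    no interior since d > 0. *)
Lemma conv_hull_rem s x : (0 < d)%N -> x \in s ->
  interior (conv_hull s : set 'M[R]_(1, d)) x -> conv_hull (rem x s) = conv_hull s.
Proof.
move=> d0 xs /interior_normP[e e0 eA].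
have e2 : 0 < e / 2 by rewrite divr_gt0.
have sub : {subset s <= x :: rem x s}.
  by move=> y; rewrite (perm_mem (perm_to_rem xs)).
have eA' y : `|x - y| < e -> conv_hull (x :: rem x s) y.
  by move=> /eA; exact: conv_hull_sub.
have [r0|rn] := eqVneq (rem x s) [::].
  have := eA' (x + (e / 2) *: const_mx 1).
  rewrite r0 conv_hull1 opprD addNKr normrN => /(_ _)/=.
  have -> : `|(e / 2) *: const_mx 1 : 'M[R]_(1, d)| = e / 2.
    rewrite normrZ gtr0_norm// [X in _ * X](_ : _ = 1) ?mulr1//.
    rewrite [LHS]/Num.norm/= mx_normrE; apply/eqP; rewrite eq_le; apply/andP; split.
      by apply/bigmax_leP; split => // i _; rewrite mxE normr1.
    apply/bigmax_geP; right; exists (ord0, Ordinal d0) => //=.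
    by rewrite mxE normr1.
  have -> : (e / 2 < e) by lra.
  move=> /(_ isT) /eqP; rewrite -subr_eq0 addrC addKr scaler_eq0 gt_eqF//=.
  by move=> /eqP/matrixP/(_ ord0 (Ordinal d0))/eqP; rewrite !mxE oner_eq0.
apply/seteqP; split; first by apply: conv_hull_sub; exact: mem_rem.
suff Cx : conv_hull (rem x s) x.
  apply: conv_hull_min; first exact: conv_hull_convex.
  by move=> y /sub; rewrite inE => /orP[/eqP ->//|]; exact: mem_conv_hull.
have [c cr] : exists c, c \in rem x s.
  by case: (rem x s) rn => // c r _; exists c; rewrite inE eqxx.
(* Makes the displacement [m *: (x - c)] shorter than [e]; the added 1 covers [x = c], as [s] may
   have repetitions. *)
pose m := e / 2 / (1 + `|x - c|).
have n0 : 0 < 1 + `|x - c| by rewrite ltr_wpDr.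
have m0 : 0 < m by rewrite !divr_gt0.
have /eA'/(conv_hull_cons rn)[l [b [/andP[l0 l1] Cb E]]] :
    `|x - (x + m *: (x - c))| < e.
  have mE : m * (1 + `|x - c|) = e / 2 by rewrite /m divfK// gt_eqF.
  rewrite opprD addNKr normrN normrZ gtr0_norm//.
  by move: mE; rewrite mulrDr mulr1; lra.
have q0 : 0 < 1 - l + m by lra.
(* The equation [x + m *: (x - c) = l *: x + (1 - l) *: b] solved for [x]. *)
have xE : x = (m / (1 - l + m)) *: c + (1 - m / (1 - l + m)) *: b.
  apply: (@scalerI _ _ (1 - l + m)); first by rewrite gt_eqF.
  rewrite scalerDr !scalerA.
  have -> : (1 - l + m) * (m / (1 - l + m)) = m by field; rewrite gt_eqF.
  have -> : (1 - l + m) * (1 - m / (1 - l + m)) = 1 - l by field; rewrite gt_eqF.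
  rewrite [(1 - l) *: b](_ : _ = x + m *: (x - c) - l *: x); last by rewrite E [l *: x + _]addrC addrK.
  apply/matrixP => i j; rewrite !mxE; ring.
rewrite [X in conv_hull _ X]xE.
apply: conv_hull_convex; [|exact: mem_conv_hull|exact: Cb].
rewrite divr_ge0 ?(ltW m0) ?(ltW q0)//= ler_pdivrMr// mul1r; lra.
Qed.

(* Every point y near x satisfies y = (c + y') / 2 with c in conv_hull s' and y'
   near x again; iterating this puts y in the closure of conv_hull s'. *)
Lemma conv_hull_stable s s' x (r : R) : 0 < r ->
  (forall y, `|x - y| < r -> conv_hull s y) ->
  (forall a, a \in s -> exists2 b, b \in s' & `|a - b| <= r / 4) ->
  forall y, `|x - y| < r / 2 -> conv_hull s' y.
Proof.
move=> r0 rs ss'.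
have near y : conv_hull s y -> exists2 c, conv_hull s' c & `|y - c| <= r / 4.
  move: y; apply: (@conv_hull_min _ _ [set y | exists2 c, conv_hull s' c & `|y - c| <= r / 4]).
    move=> a b l /andP[l0 l1] [a' a's aa'] [b' b's bb'].
    exists (l *: a' + (1 - l) *: b'); first by apply: conv_hull_convex => //; rewrite l0.
    rewrite opprD addrACA -!scalerBr (le_trans (ler_normD _ _))// !normrZ.
    have l1' : 0 <= 1 - l by rewrite subr_ge0.
    rewrite !ger0_norm//.
    have := ler_wpM2l l0 aa'; have := ler_wpM2l l1' bb'; lra.
  by move=> a /ss'[b bs ab]; exists b => //; exact: mem_conv_hull.
have approx n y : `|x - y| < r / 2 ->
    exists2 c, conv_hull s' c & `|y - c| <= r / 2 ^+ n.
  elim: n y => [|n IH] y xy.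
    have [|c cs yc] := near y; first by apply: rs; lra.
    by exists c => //; rewrite expr0 divr1; lra.
  have [|c cs bc] := near (2%:R *: y - x).
    apply: rs; rewrite (_ : x - _ = 2%:R *: (x - y)); last first.
      by apply/matrixP => i j; rewrite !mxE; ring.
    by rewrite normrZ ger0_norm//; lra.
  have [|c' cs' yc'] := IH (2%:R *: y - c).
    rewrite (_ : x - _ = - (2%:R *: y - x - c)); last first.
      by apply/matrixP => i j; rewrite !mxE; ring.
    by rewrite normrN; lra.
  exists (2^-1 *: c + (1 - 2^-1) *: c').
    by apply: conv_hull_convex => //; apply/andP; split; lra.
  rewrite (_ : y - _ = 2^-1 *: (2%:R *: y - c - c')); last first.
    by apply/matrixP => i j; rewrite !mxE; field.
  rewrite normrZ ger0_norm; last lra.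
  rewrite exprS invfM mulrCA ler_pM2l//; lra.
move=> y xy; apply: contrapT => ys.
have : interior (~` (conv_hull s') : set 'M[R]_(1, d)) y.
  have := @conv_hull_closed _ _ s'; rewrite -openC => /interior_id ->.
  exact: ys.
move=> /interior_normP[e e0 ey].
have [n _ rn] : exists2 n : nat, True & r / 2 ^+ n < e.
  have [n rn] : exists n : nat, r / e < n%:R.
    exists (Num.bound (r / e)); apply: archi_boundP; exact: divr_ge0 (ltW r0) (ltW e0).
  exists n => //; rewrite ltr_pdivrMr ?exprn_gt0// mulrC -ltr_pdivrMr//.
  by rewrite (lt_trans rn)// -natrX ltr_nat ltn_expl.
have [c cs yc] := approx n y xy.
by apply: (ey c) => //; apply: le_lt_trans yc rn.
Qed.

End HullInterior.

(** * The boundary of a hull is Lebesgue-null *)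

Section HullBoundary.
Context {R : realType} {d : nat}.
Implicit Types (x y : 'rV[R]_d) (s : seq 'rV[R]_d).

Definition hyperplane (v : 'cV[R]_d) (c : R) : set 'rV[R]_d :=
  [set x | (x *m v) ord0 ord0 = c].

Lemma mulmx_norm_le n (u : 'rV[R]_d) (M : 'M[R]_(d, n)) :
  \sum_i `|(u *m M) ord0 i| <= `|u| * \sum_i \sum_j `|M j i|.
Proof.
rewrite mulr_sumr; apply: ler_sum => i _.
rewrite mxE (le_trans (ler_norm_sum _ _ _))// mulr_sumr; apply: ler_sum => j _.
rewrite normrM ler_wpM2r//.
rewrite [leRHS]/Num.norm/= mx_normrE; apply/bigmax_geP; right.
by exists (ord0, j).
Qed.

(** If the vertices of positive weight lie on no common hyperplane, their differences span the
    space. A small displacement is then a combination of these differences with small coefficients,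
    and adding them to the weights, with a compensation at [i0], keeps the weights nonnegative of
    sum 1. *)
Lemma affine_span_interior s (w : 'I_(size s) -> R) (S : {set 'I_(size s)}) :
  (forall i, 0 <= w i) -> \sum_i w i = 1 -> S = [set i | 0 < w i]%SET ->
  (forall v c, (forall i, i \in S -> hyperplane v c s`_i) -> v = 0) ->
  interior (conv_hull s : set 'M[R]_(1, d)) (\sum_i w i *: s`_i).
Proof.
move=> w0 w1 SE Sv; set x := \sum_i _.
have [i0 i0S] : exists i0, i0 \in S.
  have [//|n] := pselect (exists i0, i0 \in S).
  suff /eqP : \sum_i w i = 0 by rewrite w1 oner_eq0.
  rewrite big1// => i _; apply/eqP; rewrite eq_le w0 andbT leNgt.
  by apply/negP => wi; apply: n; exists i; rewrite SE inE.
pose A : 'M[R]_(size s, d) := \matrix_i (if i \in S then s`_i - s`_i0 else 0).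
have fullA : row_full A.
  rewrite -[row_full _]/(_ == _) -mxrank_tr -[_ == _]/(row_free A^T).
  rewrite -kermx_eq0; apply/eqP/row_matrixP => j; rewrite row0.
  have : row j (kermx A^T) *m A^T = 0 by rewrite -row_mul mulmx_ker row0.
  set v := row j _ => vA; apply: trmx_inj; rewrite trmx0.
  apply: (Sv _ ((s`_i0 *m v^T) ord0 ord0)) => i iS.
  have /(congr1 (row i)) : A *m v^T = 0.
    by apply: trmx_inj; rewrite trmx_mul trmxK vA trmx0.
  rewrite row_mul row0 rowK iS mulmxBl => /subr0_eq.
  by rewrite /hyperplane/= => ->.
pose M := pinvmx A; pose K := \sum_i \sum_j `|M j i|.
have K0 : 0 <= K by apply: sumr_ge0 => i _; apply: sumr_ge0 => j _.
have [e e0 ew] : exists2 e : R, 0 < e & forall i, i \in S -> e <= w i.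
  exists (\big[Num.min/1]_(i in S) w i).
    by elim/big_ind: _ => // [a b a0 b0|i]; [rewrite lt_min a0|rewrite SE inE].
  by move=> i iS; rewrite (bigD1 i)//= ge_min lexx.
(* The weight at [i0] changes by two terms, each at most the sum of the |q_i|; the factor 2 makes
   that total at most [e], and the 1 keeps the denominator positive. *)
apply/interior_normP; exists (e / (2 * K + 1)).
  by rewrite divr_gt0// ltr_wpDl// mulr_ge0.
move=> y xy; pose u := y - x; pose q := u *m M.
have qs : 2 * \sum_i `|q ord0 i| <= e.
  have := mulmx_norm_le u M; rewrite -/q -/K => qK.
  have : `|u| * (2 * K + 1) <= e.
    rewrite -ler_pdivlMr; last by rewrite ltr_wpDl// mulr_ge0.
    by rewrite ltW// /u distrC.
  by have := normr_ge0 u; lra.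
have uE : u = \sum_(i in S) q ord0 i *: (s`_i - s`_i0).
  have <- : q *m A = u by rewrite mulmxKpV// submx_full.
  rewrite mulmx_sum_row [RHS]big_mkcond; apply: eq_bigr => i _.
  by rewrite rowK; case: ifP => // _; rewrite scaler0.
pose Q := \sum_(i in S) q ord0 i.
have qi i : `|q ord0 i| <= \sum_i `|q ord0 i|.
  by rewrite (bigD1 i)//= lerDl sumr_ge0.
have QQ : `|Q| <= \sum_i `|q ord0 i|.
  rewrite (le_trans (ler_norm_sum _ _ _))// big_mkcond/=; apply: ler_sum => i _.
  by case: ifP.
exists (fun i => w i + (if i \in S then q ord0 i else 0) - (if i == i0 then Q else 0)).
split.
- move=> i; have := qi i; have := QQ; move: qs.
  have [->|ii0] := eqVneq i i0.
    rewrite i0S; have := ew _ i0S; rewrite !ler_norml; lra.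
  case: ifPn => iS; last by have := w0 i; lra.
  by have := ew _ iS; rewrite !ler_norml; lra.
- rewrite big_split big_split/= w1 sumrN -!big_mkcond/= big_pred1_eq -/Q.
  by rewrite addrK.
- have -> : y = x + u by rewrite addrC subrK.
  rewrite uE; under [X in _ + X]eq_bigr do rewrite scalerBr.
  rewrite sumrB -scaler_suml -/Q.
  under [RHS]eq_bigr do rewrite scalerBl scalerDl.
  rewrite sumrB big_split/= -/x addrA; congr (_ + _ - _).
    rewrite big_mkcond; apply: eq_bigr => i _; case: ifP => // _.
    by rewrite scale0r.
  rewrite (bigD1 i0)//= eqxx big1 ?addr0// => i /negPf ->.
  by rewrite scale0r.
Qed.

(** By [affine_span_interior], the positive-weight vertices of a boundary point lie on one
    hyperplane, and so does the point. One hyperplane per set of vertices is enough, which keeps the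
    family finite. *)
Lemma conv_hull_boundary s : (0 < d)%N ->
  exists (v : {set 'I_(size s)} -> 'cV[R]_d) (c : {set 'I_(size s)} -> R),
    (forall S, v S != 0) /\
    conv_hull s `\` interior (conv_hull s : set 'M[R]_(1, d))
      `<=` \bigcup_S hyperplane (v S) (c S).
Proof.
move=> d0.
have H (S : {set 'I_(size s)}) : exists p : 'cV[R]_d * R, p.1 != 0 /\
    ((exists v c, v != 0 /\ forall i, i \in S -> hyperplane v c s`_i) ->
     forall i, i \in S -> hyperplane p.1 p.2 s`_i).
  have [[v [c [v0 vS]]]|n] := pselect (exists v c, v != 0 /\ forall i, i \in S -> hyperplane v c s`_i).
    by exists (v, c).
  (* Sets of vertices on no common hyperplane get an arbitrary one; only its normal has to be
     nonzero. *)
  exists (const_mx 1, 0); split => //=.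
  by apply/eqP => /matrixP/(_ (Ordinal d0) ord0)/eqP; rewrite !mxE oner_eq0.
have [p pP] := choice H.
exists (fun S => (p S).1), (fun S => (p S).2); split; first by move=> S; case: (pP S).
move=> _ [[w [w0 w1 ->]] ni].
pose S := [set i | 0 < w i]%SET; exists S => //.
have [_ pS] := pP S.
have [h|n] := pselect (exists v c, v != 0 /\ forall i, i \in S -> hyperplane v c s`_i).
  rewrite /hyperplane/= mulmx_suml summxE -[RHS]mul1r -w1 mulr_suml.
  apply: eq_bigr => i _; rewrite -scalemxAl mxE.
  have [wi|] := boolP (0 < w i).
    by congr (_ * _); apply: (pS h); rewrite inE.
  by rewrite lt0r w0 andbT negbK => /eqP ->; rewrite !mul0r.
exfalso; apply: ni; apply: (@affine_span_interior s w S) => // v c vS.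
by apply/eqP/negP => /negP v0; apply: n; exists v, c.
Qed.
End HullBoundary.

(** * Bounded pieces of hyperplanes are Lebesgue-null *)

Section HyperplaneNull.
Context {R : realType} {d : nat}.
Implicit Types (x y : 'rV[R]_d).

Lemma boxvol_ge0 (a b : 'rV[R]_d) : 0 <= boxvol a b.
Proof. by apply: prodr_ge0 => i _; rewrite le_max lexx orbT. Qed.

(** The finite cover is padded with degenerate boxes; these have volume 0 because d > 0, the empty
    product being 1. *)
Lemma lebesgue_null_fin (A : set 'rV[R]_d) : (0 < d)%N ->
  (forall eps : R, 0 < eps -> exists (I : finType) (a b : I -> 'rV[R]_d),
    A `<=` \bigcup_i box (a i) (b i) /\ \sum_i boxvol (a i) (b i) <= eps) ->
  lebesgue_null A.
Proof.
move=> d0 H eps /H[I [a [b [Aab ve]]]].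
pose p m := nth (0, 0) [seq (a i, b i) | i <- enum I] m.
exists (fun m => (p m).1), (fun m => (p m).2); split.
  move=> x /Aab[i _ xi]; exists (enum_rank i) => //.
  by rewrite /p (nth_map i) ?nth_enum_rank//= -cardE.
move=> N; apply: le_trans ve.
pose g m := boxvol (p m).1 (p m).2.
have g0 m : 0 <= g m by exact: boxvol_ge0.
have -> : \sum_i boxvol (a i) (b i) = \sum_(0 <= m < #|I|) g m.
  rewrite -big_enum/= -(big_map (fun i => (a i, b i)) xpredT (fun q => boxvol q.1 q.2)).
  by rewrite (big_nth (0, 0)) size_map -cardE.
rewrite -(big_mkord xpredT g).
apply: (@le_trans _ _ (\sum_(0 <= m < N + #|I|) g m)).
  by rewrite (@big_cat_nat _ _ _ N 0 (N + #|I|))//= ?leq_addr// lerDl sumr_ge0.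
rewrite (@big_cat_nat _ _ _ #|I| 0 (N + #|I|))//= ?leq_addl//.
rewrite gerDl le_eqVlt; apply/orP; left; apply/eqP.
rewrite big_nat_cond big1// => m /andP[/andP[mI _] _].
rewrite /g /p nth_default; last by rewrite size_map -cardE.
rewrite /boxvol (bigD1 (Ordinal d0))//= !mxE subrr maxxx mul0r//.
Qed.

(* The box is cut into cubes of side h; over each of the (n+1)^(d-1) cubes of a
   coordinate hyperplane k with v_k <> 0, the hyperplane has height O(h). *)
Lemma hyperplane_null (v : 'cV[R]_d) (c M : R) : v != 0 -> 0 < M ->
  lebesgue_null (hyperplane v c `&` box (const_mx (- M)) (const_mx M)).
Proof.
move=> v0 M0.
have [k vk] : exists k, v k ord0 != 0.
  apply: contrapT => n; move/eqP: v0; apply; apply/matrixP => i j.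
  by rewrite ord1 mxE; apply/eqP/negP => /negP vi; apply: n; exists i.
have d0 : (0 < d)%N by exact: leq_ltn_trans (ltn_ord k).
apply: lebesgue_null_fin => // eps e0.
pose L := (\sum_(j | j != k) `|v j ord0|) / `|v k ord0|.
have L0 : 0 <= L by rewrite divr_ge0// sumr_ge0.
(* The total volume is [2 * L * h * (n.+1 * h) ^ (d - 1)], and [n.+1 * h = 2 * M + h] is at most
   [4 * M]. *)
pose K := 2 * L * (4 * M) ^+ d.-1.
have M4 : 0 <= 4 * M by rewrite mulr_ge0// ltW.
have K0 : 0 <= K by rewrite mulr_ge0 ?exprn_ge0// mulr_ge0.
have [n n0 nK] : exists2 n : nat, (0 < n)%N & K * (2 * M / n%:R) <= eps.
  exists (Num.bound (K * (2 * M) / eps)).+1 => //.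
  rewrite mulrA ler_pdivrMr ?ltr0n// [eps * _]mulrC -ler_pdivrMr//.
  have q0 : 0 <= K * (2 * M) / eps.
    by rewrite divr_ge0 ?(ltW e0)// mulr_ge0// mulr_ge0// ltW.
  by rewrite (le_trans (ltW (archi_boundP q0)))// ler_nat.
pose h := 2 * M / n%:R.
have h0 : 0 < h by rewrite divr_gt0 ?ltr0n// mulr_gt0.
have hn : h * n%:R = 2 * M by rewrite divfK// pnatr_eq0 -lt0n.
pose F := {ffun 'I_d -> 'I_n.+1}.
pose p (f : F) j : R := - M + h * (f j)%:R.
pose q (f : F) := (c - \sum_(j | j != k) p f j * v j ord0) / v k ord0.
(* The entry [f k] is a dummy: only [f k = 0] gives a box that matters, the others have zero width
   in direction [k]. Indexing by all functions lets the sum of volumes factor into a product over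
   coordinates. *)
pose a (f : F) : 'rV[R]_d := \row_j
  (if j == k then (if f k == ord0 then q f - L * h else 0) else p f j).
pose b (f : F) : 'rV[R]_d := \row_j
  (if j == k then (if f k == ord0 then q f + L * h else 0) else p f j + h).
exists F, a, b; split.
  move=> x [xH xM].
  have xj j : exists i : 'I_n.+1, - M + h * i%:R <= x ord0 j <= - M + h * i%:R + h.
    have /andP[] := xM j; rewrite !mxE => x1 x2.
    have y0 : 0 <= (x ord0 j + M) / h by rewrite divr_ge0 ?(ltW h0)//; lra.
    have := Num.Theory.truncn_itv y0; set i := Num.truncn _ => /andP[i1 i2].
    have ih : h * i%:R <= x ord0 j + M by rewrite mulrC -ler_pdivlMr.
    have ih2 : x ord0 j + M < h * i%:R + h.
      by move: i2; rewrite ltr_pdivrMr// -natr1 mulrDl mul1r mulrC.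
    have il : (i < n.+1)%N.
      rewrite ltnS -(ler_nat R) -(ler_pM2l h0) hn; lra.
    by exists (Ordinal il) => /=; apply/andP; split; lra.
  have [f fP] := choice xj.
  exists [ffun j => if j == k then ord0 else f j] => //.
  move=> j; rewrite !mxE; case: ifPn => [/eqP ->|jk]; last first.
    by rewrite /p ffunE (negPf jk) fP.
  rewrite !ffunE !eqxx/=.
  set g := [ffun _ => _].
  have pg i : i != k -> `|x ord0 i - p g i| <= h.
    by move=> ik; rewrite /p ffunE (negPf ik) ler_norml; have := fP i; lra.
  have : `|x ord0 k - q g| <= L * h.
    have -> : x ord0 k - q g =
        - (\sum_(i | i != k) (x ord0 i - p g i) * v i ord0) / v k ord0.
      move: xH; rewrite /hyperplane/= mxE (bigD1 k)//= => xH.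
      under [in RHS]eq_bigr do rewrite mulrBl.
      rewrite sumrB /q -xH; field; exact: vk.
    rewrite normrM normrN normfV /L mulrAC ler_pM2r ?invr_gt0 ?normr_gt0//.
    rewrite (le_trans (ler_norm_sum _ _ _))// mulr_suml ler_sum// => i ik.
    by rewrite normrM mulrC ler_wpM2l// pg.
  by rewrite ler_norml; lra.
pose G (j : 'I_d) (i : 'I_n.+1) : R :=
  if j == k then (if i == ord0 then 2 * L * h else 0) else h.
have -> : \sum_f boxvol (a f) (b f) = \sum_(f : F) \prod_j G j (f j).
  apply: eq_bigr => f _; apply: eq_bigr => j _; rewrite !mxE /G.
  case: eqP => [->|_].
    case: ifP => _; last by rewrite subrr maxxx.
    rewrite max_l; first by ring.
    by have := mulr_ge0 L0 (ltW h0); lra.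
  by rewrite max_l; [ring|lra].
rewrite -(bigA_distr_bigA G) (bigD1 k)//=.
have -> : \sum_(i < n.+1) G k i = 2 * L * h.
  rewrite (bigD1 ord0)//= /G !eqxx big1 ?addr0// => i /negPf ->.
  by [].
have -> : \prod_(i | i != k) \sum_(j < n.+1) G i j =
    \prod_(i | i != k) (n.+1%:R * h).
  apply: eq_bigr => i /negPf ik; rewrite /G ik sumr_const card_ord.
  by rewrite mulr_natl.
rewrite prodr_const cardC1 card_ord.
apply: le_trans nK; rewrite -/h /K mulrAC ler_wpM2r ?(ltW h0)//.
have L2 : 0 <= 2 * L by rewrite mulr_ge0.
rewrite ler_wpM2l//.
rewrite lerXn2r ?nnegrE ?mulr_ge0 ?ler0n ?(ltW h0) ?(ltW M0)//.
rewrite -natr1 mulrDl mul1r mulrC hn.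
have : h * 1 <= h * n%:R by rewrite ler_pM2l// ler1n.
lra.
Qed.

End HyperplaneNull.

(** * Absolutely continuous measures do not charge the boundary of a hull *)

Section AbsCont.
Context {R : realType} {d : nat}.

Lemma open_measurable_Rd (A : set 'M[R]_(1, d)) :
  open A -> measurable (A : set (Rd R d)).
Proof. exact: sub_sigma_algebra. Qed.

Lemma closed_measurable_Rd (A : set 'M[R]_(1, d)) :
  closed A -> measurable (A : set (Rd R d)).
Proof.
rewrite -openC => /open_measurable_Rd/measurableC.
by rewrite setCK.
Qed.

Lemma hyperplane_closed (v : 'cV[R]_d) (c : R) :
  closed (hyperplane v c : set 'M[R]_(1, d)).
Proof.
have -> : hyperplane v c =
    (fun x : 'M[R]_(1, d) => \sum_j x ord0 j * v j ord0) @^-1` [set c].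
  by apply/seteqP; split => x; rewrite /hyperplane/= mxE.
apply: closed_comp; last exact: closed_eq.
move=> x _; move: x; apply: continuous_big => [|j _ x]; first exact: add_continuous.
by apply: (@continuousM R 'M[R]_(1, d) (fun y => y ord0 j)); [exact: (@coord_continuous R 1 d ord0 j x)|exact: cst_continuous].
Qed.

Lemma abs_cont_hyperplane (mu : probability (Rd R d) R) (v : 'cV[R]_d) (c : R) :
  abs_cont_leb mu -> v != 0 -> mu (hyperplane v c) = 0%E.
Proof.
move=> ac v0.
(* [hyperplane_null] covers bounded pieces only, so the hyperplane is exhausted by balls of the sup
   norm, which are boxes. *)
pose B (n : nat) : set 'M[R]_(1, d) := [set x | `|x| <= n.+1%:R].
have cB n : closed (B n).
  rewrite (_ : B n = (fun x : 'M[R]_(1, d) => `|x|) @^-1` [set y | y <= n.+1%:R])//.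
  apply: closed_comp; last exact: closed_le.
  by move=> x _; exact: norm_continuous.
have mH := closed_measurable_Rd (@hyperplane_closed v c).
apply/negligibleP => //.
have -> : hyperplane v c = \bigcup_n (hyperplane v c `&` B n).
  rewrite -setI_bigcupr [X in _ `&` X](_ : _ = setT) ?setIT//.
  apply/seteqP; split => // x _; exists (Num.bound `|x|) => //.
  by rewrite /B/= (le_trans (ltW (archi_boundP _)))// ler_nat.
apply: negligible_bigcup => n.
have mI : measurable ((hyperplane v c `&` B n) : set (Rd R d)).
  by apply: measurableI => //; exact: closed_measurable_Rd.
apply/negligibleP => //; apply: ac => //.
have n0 : 0 < n.+1%:R :> R by [].
move=> eps /(hyperplane_null c v0 n0)[a [b [Hab ve]]].
exists a, b; split => //; apply: subset_trans Hab => x [xH xB]; split => // i.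
rewrite !mxE -ler_norml; apply: le_trans xB.
by rewrite [leRHS]/Num.norm/= mx_normrE; apply/bigmax_geP; right; exists (ord0, i).
Qed.

Lemma conv_hull_measurable (s : seq 'rV[R]_d) : measurable (conv_hull s : set (Rd R d)).
Proof. by apply: closed_measurable_Rd; exact: conv_hull_closed. Qed.

Definition int_hull (s : seq 'rV[R]_d) : set 'rV[R]_d :=
  interior (conv_hull s : set 'M[R]_(1, d)).

Lemma int_hull_measurable (s : seq 'rV[R]_d) : measurable (int_hull s : set (Rd R d)).
Proof. by apply: open_measurable_Rd; exact: open_interior. Qed.

(** The bridge from the mass of the open interior, which the Mecke argument produces, to the mass of
    the hull. *)
Lemma abs_cont_conv_hull (mu : probability (Rd R d) R) (s : seq 'rV[R]_d) :
  (0 < d)%N -> abs_cont_leb mu -> mu (conv_hull s) = mu (int_hull s).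
Proof.
move=> d0 ac; have [v [c [v0 sub]]] := conv_hull_boundary s d0.
have mC := conv_hull_measurable s; have mI := int_hull_measurable s.
have sI : int_hull s `<=` conv_hull s by exact: interior_subset.
rewrite -{1}(setDUK sI) measureU//; last 2 first.
- exact: measurableD.
- by rewrite setDIK.
rewrite [X in (_ + X)%E](_ : _ = 0%E) ?adde0//.
apply/negligibleP; first exact: measurableD.
pose F n := if unpickle n is Some J then hyperplane (v J) (c J) : set (Rd R d) else set0.
apply: (@negligibleS _ _ _ _ (\bigcup_n F n)).
  move=> x /sub[S _ xS]; exists (pickle S) => //.
  by rewrite /F pickleK.
apply: negligible_bigcup => n; rewrite /F.
case: unpickle => [J|]; last exact: negligible_set0.
apply/negligibleP; first by apply: closed_measurable_Rd; exact: hyperplane_closed.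
exact: abs_cont_hyperplane.
Qed.

End AbsCont.

(** * Cells of a countable base *)

Section Cells.
Context {R : realType} {d : nat}.
Implicit Types (x y : 'rV[R]_d) (s : seq 'rV[R]_d).

Definition rball (n : nat) : set 'M[R]_(1, d) :=
  if (unpickle n : option ('rV[rat]_d * nat)) is Some (q, k)
  then [set x | `|map_mx ratr q - x| < k.+1%:R^-1] else set0.

Lemma rball_open n : open (rball n).
Proof.
rewrite /rball; case: unpickle => [[q k]|]; last exact: open0.
rewrite (_ : mkset _ = ball (map_mx ratr q : 'M[R]_(1, d)) k.+1%:R^-1).
  exact: ball_open.
by rewrite -ball_normE.
Qed.

Lemma rball_base x (e : R) : 0 < e ->
  exists n, rball n x /\ forall y, rball n y -> `|x - y| < e.
Proof.
move=> e0.
(* The radius is below [e / 2], so any two points of the ball are at distance less than [e]. *)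
pose k := Num.bound (2 / e).
have ke : k.+1%:R^-1 < e / 2 :> R.
  rewrite -[e / 2]invf_div ltf_pV2 ?posrE ?divr_gt0//.
  have := archi_boundP (ltW (divr_gt0 (ltr0n R 2) e0)) => /lt_le_trans; apply.
  by rewrite ler_nat.
have k0 : 0 < k.+1%:R^-1 :> R by rewrite invr_gt0.
have H j : exists q : rat, `|ratr q - x ord0 j| < k.+1%:R^-1.
  have := @rat_in_itvoo R (x ord0 j - k.+1%:R^-1) (x ord0 j + k.+1%:R^-1).
  case; first by rewrite ltrD2l; move: (k.+1%:R^-1) k0 => z; lra.
  move=> q; rewrite in_itv/= => /andP[q1 q2]; exists q.
  by rewrite distrC ltr_distlC q1 q2.
have [q qP] := choice H.
pose Q : 'rV[rat]_d := \row_j q j.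
have Qx : `|map_mx ratr Q - x| < k.+1%:R^-1.
  rewrite [ltLHS]/Num.norm/= mx_normrE; apply/bigmax_ltP; split => // -[i j] _ /=.
  by rewrite !mxE ord1.
exists (pickle (Q, k)); rewrite /rball pickleK/=; split => // y Qy.
rewrite (_ : x - y = - (map_mx ratr Q - x) + (map_mx ratr Q - y)); last first.
  by rewrite opprB addrA subrK.
rewrite (le_lt_trans (ler_normD _ _))// normrN.
by move: Qx Qy ke; move: (k.+1%:R^-1) => z; lra.
Qed.

(* The level-l cell of a point records which of the first l rational balls
   contain it; cells of level l+1 refine those of level l. *)
Definition cell l x : {ffun 'I_l -> bool} := [ffun i => x \in rball (val i)].

Definition cellset l (c : {ffun 'I_l -> bool}) : set 'rV[R]_d :=
  [set x | cell l x = c].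

Definition cnt l s : {ffun {ffun 'I_l -> bool} -> nat} :=
  [ffun c => count (fun x => cell l x == c) s].

Definition decr l (i : {ffun 'I_l -> bool}) (c : {ffun {ffun 'I_l -> bool} -> nat})
  : {ffun {ffun 'I_l -> bool} -> nat} := [ffun j => (c j - (j == i))%N].

Lemma cellset_measurable l c : measurable (@cellset l c : set (Rd R d)).
Proof.
have -> : @cellset l c = \bigcap_(i : 'I_l)
   (if c i then rball (val i) else ~` rball (val i)).
  apply/seteqP; split => [x <- i _|x xc]; rewrite ?ffunE.
    by case: ifPn; rewrite ?inE// => /negP xn /mem_set.
  apply/ffunP => i; rewrite ffunE; have := xc i I.
  by case: (c i) => [/mem_set//|xn]; apply/negP => /set_mem.
apply: fin_bigcap_measurable; first exact: finite_finset.
move=> i _; have m : measurable (rball (val i) : set (Rd R d)).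
  by apply: open_measurable_Rd; exact: rball_open.
by case: (c i) => //; exact: measurableC.
Qed.

Lemma cntE l s c : cnt l s c = count_in s (cellset c).
Proof.
rewrite ffunE; apply: eq_count => x.
by apply/eqP/idP => [/mem_set//|/set_mem].
Qed.

Lemma cell_pred l x y : cell l.+1 x = cell l.+1 y -> cell l x = cell l y.
Proof.
move=> /ffunP H; apply/ffunP => i.
by have := H (widen_ord (leqnSn l) i); rewrite !ffunE.
Qed.

(** Equal counts are read as equal multisets of cells, so that passing to a coarser level becomes
    [perm_map]. *)
Lemma cnt_perm l s s' :
  cnt l s = cnt l s' <-> perm_eq (map (cell l) s) (map (cell l) s').
Proof.
split=> [/ffunP H|/permP H].
  by apply/allP => c _; have := H c; rewrite !ffunE /= !count_map => /eqP.
by apply/ffunP => c; have := H (pred1 c); rewrite !ffunE !count_map.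
Qed.

Lemma cnt_pred l s s' : cnt l.+1 s = cnt l.+1 s' -> cnt l s = cnt l s'.
Proof.
move=> /cnt_perm H; apply/cnt_perm.
pose r (f : {ffun 'I_l.+1 -> bool}) := [ffun i => f (widen_ord (leqnSn l) i)].
have E t : map (cell l) t = map r (map (cell l.+1) t).
  rewrite -map_comp; apply: eq_map => x; apply/ffunP => i.
  by rewrite !ffunE.
by rewrite !E; exact: perm_map.
Qed.

Lemma cnt_rem l s x : x \in s -> cnt l (rem x s) = decr (cell l x) (cnt l s).
Proof.
move=> xs; apply/ffunP => c; rewrite !ffunE.
by rewrite (permP (perm_to_rem xs))/= eq_sym addKn.
Qed.

Lemma cell_small x (e : R) : 0 < e ->
  exists l, forall m y, (l <= m)%N -> cell m x = cell m y -> `|x - y| < e.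
Proof.
move=> /(rball_base x)[n [nx ny]]; exists n.+1 => m y nm /ffunP/(_ (Ordinal nm)).
rewrite !ffunE/= (mem_set nx) => /esym ynx; apply: ny.
exact: set_mem.
Qed.

Lemma cell_small_seq s (e : R) : 0 < e ->
  exists l, forall m x y, (l <= m)%N -> x \in s -> cell m x = cell m y -> `|x - y| < e.
Proof.
move=> e0; elim: s => [|a s [l IH]]; first by exists 0%N.
have [l' al'] := cell_small a e0.
exists (maxn l l') => m x y; rewrite geq_max inE => /andP[lm lm'] /orP[/eqP ->|xs].
  exact: al'.
exact: IH.
Qed.

(** Interiority that can be certified from discrete data alone. Quantifying over all realisations of
    the data gives soundness at once, and monotonicity in [l] because finer data has fewer
    realisations. *)
Definition surely_int l (i : {ffun 'I_l -> bool}) c : bool :=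
  `[< forall x s, cell l x = i -> cnt l s = c -> int_hull s x >].

Lemma surely_int_sound l s x :
  surely_int (cell l x) (cnt l s) -> int_hull s x.
Proof. by move=> /asboolP; exact. Qed.

Lemma surely_int_mono l s x : surely_int (cell l x) (cnt l s) ->
  surely_int (cell l.+1 x) (cnt l.+1 s).
Proof.
move=> /asboolP H; apply/asboolP => x' s' /cell_pred xx' /cnt_pred ss'.
exact: H.
Qed.

Lemma surely_int_le l m s x : (l <= m)%N -> surely_int (cell l x) (cnt l s) ->
  surely_int (cell m x) (cnt m s).
Proof.
move=> lm H; rewrite -(subnK lm); elim: (m - l)%N => //= n IH.
exact: surely_int_mono.
Qed.

(** At a fine enough level, every configuration with the same counts has a point within [r / 4] of
    each point of [s], so by [conv_hull_stable] its hull contains the ball of radius [r / 2] about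
    [x]. A point in the cell of [x] is within [r / 4] of [x], which leaves a ball of radius [r / 4]
    around it. *)
Lemma surely_int_complete s x : int_hull s x ->
  exists l, surely_int (cell l x) (cnt l s).
Proof.
move=> /interior_normP[r r0 rs].
have r4 : 0 < r / 4 by rewrite divr_gt0.
have [l1 H1] := cell_small x r4.
have [l2 H2] := cell_small_seq s r4.
exists (maxn l1 l2); set l := maxn l1 l2; apply/asboolP => x' s' xx' ss'.
have xx'4 : `|x - x'| < r / 4 by apply: (H1 l); rewrite ?leq_maxl.
apply/interior_normP; exists (r / 4) => // y x'y.
apply: (@conv_hull_stable _ _ s s' x r) => //.
  move=> a aS; have : (0 < cnt l s' (cell l a))%N.
    rewrite ss' ffunE -has_count; apply/hasP; exists a => //.
  rewrite ffunE -has_count => /hasP[b bs' /eqP ba]; exists b => //.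
  by apply: ltW; apply: (H2 l); rewrite ?leq_maxr.
rewrite (_ : x - y = (x - x') + (x' - y)); last by rewrite addrA subrK.
by rewrite (le_lt_trans (ler_normD _ _))//; lra.
Qed.

Lemma sum_cnt l s (F : {ffun 'I_l -> bool} -> R) :
  \sum_i (cnt l s i)%:R * F i = \sum_(x <- s) F (cell l x).
Proof.
elim: s => [|a s IH].
  by rewrite big_nil big1// => i _; rewrite ffunE mul0r.
rewrite big_cons -IH (bigD1 (cell l a))//= [in RHS](bigD1 (cell l a))//=.
rewrite addrA !ffunE/= eqxx natrD mulrDl mul1r; congr (_ + _).
by apply: eq_bigr => i ia; rewrite !ffunE/= eq_sym (negPf ia).
Qed.

End Cells.

Arguments surely_int R d {l} i c.

(** * Poisson counts of finitely many cells *)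

Section DiscreteIntegral.
Context {R : realType} {dT : measure_display} {T : measurableType dT}.
Context (P : {measure set T -> \bar R}) (K : countType) (X : T -> K).
Hypothesis mX : forall k, measurable (X @^-1` [set k]).

Lemma preimage_discrete_measurable (A : set K) : measurable (X @^-1` A).
Proof.
pose F n : set T := if unpickle n is Some k
  then if k \in A then X @^-1` [set k] else set0 else set0.
have -> : X @^-1` A = \bigcup_n F n.
  apply/seteqP; split => [w Aw|w [n _]].
    by exists (pickle (X w)) => //; rewrite /F pickleK mem_set.
  rewrite /F; case: unpickle => // k; case: ifPn => // /set_mem kA Xk.
  by rewrite /preimage/= Xk.
apply: bigcup_measurable => n _; rewrite /F.
case: unpickle => [k|]; last exact: measurable0.
by case: ifP => _ //; exact: measurable0.
Qed.

Lemma measurable_fun_discrete (G : K -> \bar R) :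
  measurable_fun setT (fun w => G (X w)).
Proof.
move=> _ Y mY; rewrite setTI.
exact: (preimage_discrete_measurable (G @^-1` Y)).
Qed.

Lemma integral_discrete (G : K -> \bar R) : (forall k, 0 <= G k)%E ->
  (\int[P]_w G (X w) = \esum_(k in setT) (G k * P (X @^-1` [set k])))%E.
Proof.
move=> G0; pose F n : set T := [set w | pickle (X w) = n].
have mF n : measurable (F n).
  exact: (preimage_discrete_measurable [set k | pickle k = n]).
have FT : \bigcup_n F n = setT.
  by apply/seteqP; split => // w _; exists (pickle (X w)).
rewrite -FT ge0_integral_bigcup//; last 2 first.
- rewrite FT; exact: measurable_fun_discrete.
- by move=> i j _ _ [w [<- <-]].
rewrite nneseries_esumT; last by move=> n; apply: integral_ge0.
transitivity (\esum_(n in range (@pickle K)) \int[P]_(w in F n) G (X w))%E.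
  rewrite [RHS]esum_mkcond; apply: eq_esum => n _.
  case: ifPn => // /negP nr; rewrite (_ : F n = set0) ?integral_set0//.
  by rewrite -subset0 => w wn; apply: nr; rewrite inE; exists (X w).
rewrite (@reindex_esum _ _ _ setT (range (@pickle K)) (@pickle K)); last first.
  split; [by move=> k _; exists k| |by move=> n [k _ <-]; exists k].
  by move=> k k' _ _; exact: (pcan_inj pickleK).
apply: eq_esum => k _.
have -> : F (pickle k) = X @^-1` [set k].
  apply/seteqP; split => w; last by move=> /= <-.
  by move=> /(pcan_inj pickleK).
rewrite -integral_cst//; apply: eq_integral => w /set_mem /= ->.
by [].
Qed.

End DiscreteIntegral.

(** * The Mecke formula for cell counts *)

Section DiscreteMecke.
Context {R : realType} {d : nat} {dT : measure_display} {T : measurableType dT}.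
Context (P : probability T R) (mu : probability (Rd R d) R) (t : R).
Context (eta : T -> seq 'rV[R]_d).
Hypothesis t0 : 0 < t.
Hypothesis heta : poisson_pp P t mu eta.

Let cellmu l (i : {ffun 'I_l -> bool}) : R := fine (mu (cellset i : set (Rd R d))).

(** Indexing by ordinals puts the event in the form of the independence clause of [poisson_pp]. *)
Lemma cnt_preimage l c : (fun w => cnt l (eta w)) @^-1` [set c] =
  \bigcap_(i : 'I_#|{ffun 'I_l -> bool}|)
    [set w | count_in (eta w) (cellset (enum_val i : {ffun 'I_l -> bool})) = c (enum_val i)].
Proof.
apply/seteqP; split => [w /= <- i _|w H]; first by rewrite /= -cntE.
by apply/ffunP => i; have := H (enum_rank i) I; rewrite /= enum_rankK -cntE.
Qed.

Lemma cnt_measurable l c : measurable ((fun w => cnt l (eta w)) @^-1` [set c]).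
Proof.
have [_ m _ _] := heta.
rewrite cnt_preimage; apply: fin_bigcap_measurable; first exact: finite_finset.
by move=> i _; apply: m; exact: cellset_measurable.
Qed.

Lemma cnt_prob l (c : {ffun {ffun 'I_l -> bool} -> nat}) :
  P ((fun w => cnt l (eta w)) @^-1` [set c]) =
  (\prod_i poisson_mass (t * cellmu i) (c i))%:E.
Proof.
have [_ m p ind] := heta.
rewrite -[LHS]fineK ?fin_num_measure//; last exact: cnt_measurable.
congr (_%:E); rewrite cnt_preimage.
rewrite (ind _ (fun i => cellset (enum_val i : {ffun 'I_l -> bool})) _ _
  (fun i => c (enum_val i))); last 2 first.
- by move=> i; exact: cellset_measurable.
- move=> i j ij; rewrite -subset0 => x [/= xi xj]; move/eqP: ij; apply.
  by apply: enum_val_inj; rewrite -xi -xj.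
rewrite [RHS](reindex (@enum_val {ffun 'I_l -> bool} predT)); last first.
  exact: onW_bij (enum_val_bij _).
by apply: eq_bigr => i _; rewrite p//; exact: cellset_measurable.
Qed.

Lemma poisson_massS (r : R) n : n.+1%:R * poisson_mass r n.+1 = r * poisson_mass r n.
Proof.
rewrite /poisson_mass factS natrM exprS; field.
by rewrite nat1r !pnatr_eq0 -lt0n fact_gt0.
Qed.

(** Terms with [c i = 0] vanish, and the others are reindexed by adding one point to cell [i]. The
    joint weight is a product over cells, so only its factor at [i] changes, and [poisson_massS]
    trades the factor [c i] for the intensity of the cell. *)
Lemma discrete_mecke1 l (i : {ffun 'I_l -> bool})
    (G : {ffun {ffun 'I_l -> bool} -> nat} -> R) : (forall c, 0 <= G c) ->
  (\int[P]_w ((cnt l (eta w) i)%:R * G (decr i (cnt l (eta w))))%:E =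
   \int[P]_w (t * cellmu i * G (cnt l (eta w)))%:E)%E.
Proof.
move=> G0.
have cm0 : 0 <= t * cellmu i by rewrite mulr_ge0 ?(ltW t0)// fine_ge0.
rewrite (@integral_discrete _ _ _ P _ _ (@cnt_measurable l)
  (fun c => ((c i)%:R * G (decr i c))%:E)); last first.
  by move=> c; rewrite lee_fin mulr_ge0.
rewrite (@integral_discrete _ _ _ P _ _ (@cnt_measurable l)
  (fun c => (t * cellmu i * G c)%:E)); last first.
  by move=> c; rewrite lee_fin mulr_ge0.
pose K := {ffun {ffun 'I_l -> bool} -> nat}.
pose incr (c : K) : K := [ffun j => (c j + (j == i))%N].
have decrK c : decr i (incr c) = c.
  by apply/ffunP => j; rewrite !ffunE addnK.
transitivity (\esum_(c in [set c : K | (0 < c i)%N])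
   (((c i)%:R * G (decr i c))%:E * P ((fun w => cnt l (eta w)) @^-1` [set c])))%E.
  rewrite [RHS]esum_mkcond; apply: eq_esum => c _; case: ifPn => // /negP nc.
  have -> : c i = 0%N by apply/eqP; rewrite -leqn0 leqNgt; apply/negP => h; apply: nc; rewrite inE.
  by rewrite mul0r mul0e.
rewrite (@reindex_esum _ _ _ setT _ incr); last first.
  split => [c _|c c' _ _ /(congr1 (decr i))|c ci].
  - by rewrite /= ffunE eqxx addn1.
  - by rewrite !decrK.
  - exists (decr i c) => //; apply/ffunP => j; rewrite !ffunE.
    by case: eqP => [->|_]; rewrite ?subn0 ?addn0// subnK.
apply: eq_esum => c _; rewrite decrK (cnt_prob (incr c)).
rewrite [X in (_ = _ * X)%E](cnt_prob c) -!EFinM; congr (_%:E).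
rewrite (bigD1 i)//= [in RHS](bigD1 i)//= ffunE eqxx addn1.
rewrite mulrAC mulrA poisson_massS.
rewrite (eq_bigr (fun j => poisson_mass (t * cellmu j) (c j))); last first.
  by move=> j ji; rewrite ffunE (negPf ji) addn0.
ring.
Qed.

Lemma discrete_mecke l
    (G : {ffun 'I_l -> bool} -> {ffun {ffun 'I_l -> bool} -> nat} -> R) :
  (forall i c, 0 <= G i c) ->
  (\int[P]_w (\sum_i (cnt l (eta w) i)%:R * G i (decr i (cnt l (eta w))))%:E =
   \int[P]_w (t * \sum_i cellmu i * G i (cnt l (eta w)))%:E)%E.
Proof.
move=> G0.
under eq_integral do rewrite -sumEFin.
under [RHS]eq_integral do rewrite mulr_sumr -sumEFin.
have mD (H : {ffun {ffun 'I_l -> bool} -> nat} -> \bar R) :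
    measurable_fun setT (fun w => H (cnt l (eta w))).
  exact: measurable_fun_discrete (@cnt_measurable l) _.
rewrite ge0_integral_sum//; last 2 first.
- move=> i; exact: (mD (fun c => ((c i)%:R * G i (decr i c))%:E)).
- by move=> i w _; rewrite lee_fin mulr_ge0.
rewrite ge0_integral_sum//; last 2 first.
- move=> i; exact: (mD (fun c => (t * (cellmu i * G i c))%:E)).
- by move=> i w _; rewrite lee_fin mulr_ge0 ?(ltW t0)// mulr_ge0// fine_ge0.
apply: eq_bigr => i _; rewrite discrete_mecke1//.
by apply: eq_integral => w _; rewrite mulrA.
Qed.

End DiscreteMecke.

(** * The Mecke identity for interior points *)

Section Mecke.
Context {R : realType} {d : nat} {dT : measure_display} {T : measurableType dT}.
Context (P : probability T R) (mu : probability (Rd R d) R) (t : R).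
Context (eta : T -> seq 'rV[R]_d).
Hypothesis d0 : (0 < d)%N.
Hypothesis t0 : 0 < t.
Hypothesis heta : poisson_pp P t mu eta.
Implicit Types (s : seq 'rV[R]_d) (w : T).

Lemma mu_cells l (Q : pred {ffun 'I_l -> bool}) :
  fine (mu ([set x | Q (cell l x)] : set (Rd R d))) =
  \sum_i (Q i)%:R * fine (mu (cellset i : set (Rd R d))).
Proof.
have -> : [set x | Q (cell l x)] =
    \bigcup_(i in [set i | Q i]) (@cellset R d l i : set (Rd R d)).
  by apply/seteqP; split => [x Qx|x [i /= Qi]]; [exists (cell l x)|rewrite /cellset/= => ->].
have tI : trivIset [set i | Q i] (fun i => @cellset R d l i : set (Rd R d)).
  by move=> i j _ _ [x []]; rewrite /cellset/= => -> ->.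
rewrite measure_fin_bigcup//; last 2 first.
- exact: finite_finset.
- by move=> i _; exact: cellset_measurable.
rewrite (@fsbigE _ _ _ _ _ [seq i <- enum {: {ffun 'I_l -> bool}} | Q i]); last 3 first.
- by rewrite filter_uniq ?enum_uniq.
- by move=> i; rewrite /= mem_filter => /andP[].
- by move=> i Qi; rewrite mem_filter mem_enum andbT (_ : Q i).
rewrite big_filter_cond big_enum_cond/= -sum_fine; last first.
  by move=> i _; rewrite fin_num_measure//; exact: cellset_measurable.
rewrite [RHS](bigID Q)/= [X in _ = _ + X]big1 ?addr0; last first.
  by move=> i /negPf ->; rewrite mul0r.
apply: eq_big => [i|i /andP[-> _]]; last by rewrite mul1r.
by rewrite andb_idr// => Qi; rewrite inE.
Qed.

(* Lower bound for the interior count that depends on s only through the cell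
   counts c = cnt l s; it increases to the interior count with l. *)
Definition cell_count l (c : {ffun {ffun 'I_l -> bool} -> nat}) : nat :=
  (\sum_i surely_int R d i c * c i)%N.

Definition cell_mass l (c : {ffun {ffun 'I_l -> bool} -> nat}) : R :=
  \sum_i (surely_int R d i c)%:R * fine (mu (cellset i : set (Rd R d))).

Lemma cell_countE l s :
  cell_count (cnt l s) = count (fun x => surely_int R d (cell l x) (cnt l s)) s.
Proof.
have := @sum_cnt R d l s (fun i => (surely_int R d i (cnt l s))%:R).
move=> H; apply/eqP; rewrite -(eqr_nat R); apply/eqP.
rewrite /cell_count natr_sum; transitivity (\sum_(x <- s) (surely_int R d (cell l x) (cnt l s))%:R : R).
  by rewrite -H; apply: eq_bigr => i _; rewrite natrM mulrC.
by rewrite -natr_sum -sum1_count [in RHS]big_mkcond/=; congr (_%:R); apply: eq_bigr => x _; case: ifP.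
Qed.

Lemma cell_count_le s : {homo (fun l => cell_count (cnt l s)) : l m / (l <= m)%N}.
Proof.
move=> l m lm; rewrite !cell_countE; apply: sub_count => x.
exact: surely_int_le.
Qed.

(** Each of the finitely many interior points is certified from some level on, and soundness
    excludes all other points. *)
Lemma cell_count_limit s :
  exists l, forall m, (l <= m)%N -> cell_count (cnt m s) = interior_count s.
Proof.
have [l H] : exists l, forall m x, (l <= m)%N -> x \in s -> int_hull s x ->
    surely_int R d (cell m x) (cnt m s).
  suff [l H] : exists l, forall x, x \in s -> int_hull s x ->
      surely_int R d (cell l x) (cnt l s).
    by exists l => m x lm xs /(H _ xs); exact: surely_int_le.
  (* The induction runs over the points to be certified; the configuration spanning the hull stays
     [s]. *)
  elim: {1}s => [|a s' [l IH]]; first by exists 0%N.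
  have [ai|na] := pselect (int_hull s a).
    have [l' al'] := surely_int_complete ai.
    exists (maxn l l') => x; rewrite inE => /orP[/eqP -> _|xs' xi].
      by apply: surely_int_le al'; rewrite leq_maxr.
    by apply: surely_int_le (IH _ xs' xi); rewrite leq_maxl.
  by exists l => x; rewrite inE => /orP[/eqP ->|]; [|exact: IH].
exists l => m lm; rewrite cell_countE /interior_count /count_in.
apply: eq_in_count => x xs; apply/idP/idP => [/surely_int_sound/mem_set//|/set_mem xi].
exact: H.
Qed.

Definition hull_mass s : R := fine (mu (int_hull s : set (Rd R d))).

Let sureset s l : set (Rd R d) := [set x | surely_int R d (cell l x) (cnt l s)].

Let sureset_measurable s l : measurable (sureset s l).
Proof.
have -> : sureset s l = \bigcup_(i in [set i | surely_int R d i (cnt l s)])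
    (@cellset R d l i : set (Rd R d)).
  by apply/seteqP; split => [x Qx|x [i /= Qi]]; [exists (cell l x)|rewrite /sureset /cellset/= => ->].
apply: fin_bigcup_measurable; first exact: finite_finset.
by move=> i _; exact: cellset_measurable.
Qed.

Lemma cell_massE l s : cell_mass (cnt l s) = fine (mu (sureset s l)).
Proof. exact: esym (mu_cells (fun i => surely_int R d i (cnt l s))). Qed.

Lemma cell_mass_le s : {homo (fun l => cell_mass (cnt l s)) : l m / (l <= m)%N >-> l <= m}.
Proof.
move=> l m lm; rewrite !cell_massE fine_le ?fin_num_measure// le_measure ?inE//.
by move=> x; exact: surely_int_le.
Qed.

(** The certified sets increase to the interior of the hull, so this is continuity of [mu] from
    below. *)
Lemma cell_mass_limit s : (fun l => cell_mass (cnt l s)) @ \oo --> hull_mass s.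
Proof.
have -> : (fun l => cell_mass (cnt l s)) = fine \o (fun l => mu (sureset s l)).
  by apply/funext => l; rewrite cell_massE.
apply: fine_cvg; rewrite /hull_mass fineK; last first.
  by rewrite fin_num_measure//; exact: int_hull_measurable.
have -> : int_hull s = \bigcup_l sureset s l.
  apply/seteqP; split => [x /surely_int_complete[l xl]|x [l _ /surely_int_sound//]].
  by exists l.
apply: nondecreasing_cvg_mu => //; first exact: bigcup_measurable.
by move=> l m lm; apply/subsetPset => x; exact: surely_int_le.
Qed.

Definition cell_moment m j l (c : {ffun {ffun 'I_l -> bool} -> nat}) : R :=
  ((cell_count c) ^_ m)%:R * (t * cell_mass c) ^+ j.

Definition hull_moment m j s : R :=
  ((interior_count s) ^_ m)%:R * (t * hull_mass s) ^+ j.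

Lemma cell_mass_ge0 l c : 0 <= @cell_mass l c.
Proof. by apply: sumr_ge0 => i _; rewrite mulr_ge0 ?ler0n// fine_ge0. Qed.

Lemma cell_moment_ge0 m j l c : 0 <= @cell_moment m j l c.
Proof.
by rewrite mulr_ge0// exprn_ge0// mulr_ge0 ?(ltW t0)// cell_mass_ge0.
Qed.

Lemma leq_ffact2r n p k : (n <= p)%N -> (n ^_ k <= p ^_ k)%N.
Proof.
elim: k n p => [|k IH] n p np; first by rewrite !ffactn0.
by rewrite !ffactnS leq_mul// IH//; lia.
Qed.

Lemma cell_moment_le m j s :
  {homo (fun l => cell_moment m j (cnt l s)) : k l / (k <= l)%N >-> k <= l}.
Proof.
move=> k l kl; rewrite /cell_moment ler_pM//.
- by rewrite exprn_ge0// mulr_ge0 ?(ltW t0)// cell_mass_ge0.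
- by rewrite ler_nat leq_ffact2r// cell_count_le.
- rewrite lerXn2r ?nnegrE ?mulr_ge0 ?(ltW t0) ?cell_mass_ge0//.
  by rewrite ler_pM2l// cell_mass_le.
Qed.

Lemma cell_moment_limit m j s :
  (fun l => cell_moment m j (cnt l s)) @ \oo --> hull_moment m j s.
Proof.
apply: cvgM.
  have [l H] := cell_count_limit s.
  apply: cvg_near_cst; near=> k; rewrite H//.
  by near: k; exists l.
have h : (fun l => t * cell_mass (cnt l s)) @ \oo --> t * hull_mass s.
  by apply: cvgM; [exact: cvg_cst|exact: cell_mass_limit].
exact: (cvg_comp _ _ h (@exprn_continuous R j _)).
Unshelve. all: by end_near. Qed.

(** Removing an interior point keeps the hull and lowers the interior count from I to I - 1. Each of
    the I interior points thus contributes the same term, and I (I - 1)^_m = I^_(m+1). *)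
Lemma sum_rem_hull_moment m j s :
  \sum_(x <- s) (x \in int_hull (rem x s))%:R * hull_moment m j (rem x s) =
  hull_moment m.+1 j s.
Proof.
have E x : x \in s -> (x \in int_hull (rem x s))%:R * hull_moment m j (rem x s) =
    (x \in int_hull s)%:R * (((interior_count s).-1 ^_ m)%:R * (t * hull_mass s) ^+ j).
  move=> xs; have -> : (x \in int_hull (rem x s)) = (x \in int_hull s).
    apply/idP/idP => /set_mem xi; apply/mem_set.
      move: xi; apply: interiorS.
      by apply: conv_hull_sub; exact: mem_rem.
    by rewrite /int_hull conv_hull_rem.
  have [/set_mem xi|] := boolP (x \in int_hull s); last by rewrite !mul0r.
  have hE := conv_hull_rem d0 xs xi.
  rewrite /hull_moment /hull_mass /int_hull hE; congr (_ * ((_ ^_ _)%:R * _)).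
  rewrite /interior_count hE /count_in.
  by rewrite [in RHS](permP (perm_to_rem xs))/= (mem_set xi).
rewrite big_seq (eq_bigr _ E) -big_seq -mulr_suml.
rewrite /hull_moment ffactnS natrM -mulrA; congr (_ * _).
rewrite -natr_sum /interior_count /count_in -sum1_count [in RHS]big_mkcond/=.
by congr (_%:R); apply: eq_bigr => x _; case: ifP.
Qed.

Lemma eq_monotone_limit_integral (u v : nat -> T -> R) (U V : T -> R) :
  (forall l, measurable_fun setT (u l)) -> (forall l, measurable_fun setT (v l)) ->
  (forall l w, 0 <= u l w) -> (forall l w, 0 <= v l w) ->
  (forall w, {homo (u^~ w) : l m / (l <= m)%N >-> l <= m}) ->
  (forall w, {homo (v^~ w) : l m / (l <= m)%N >-> l <= m}) ->
  (forall w, u^~ w @ \oo --> U w) -> (forall w, v^~ w @ \oo --> V w) ->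
  (forall l, \int[P]_w (u l w)%:E = \int[P]_w (v l w)%:E)%E ->
  (\int[P]_w (U w)%:E = \int[P]_w (V w)%:E)%E.
Proof.
move=> mu_ mv u0 v0 nu nv uU vV uv.
have L (f : nat -> T -> R) F : (forall l, measurable_fun setT (f l)) ->
    (forall l w, 0 <= f l w) -> (forall w, {homo (f^~ w) : l m / (l <= m)%N >-> l <= m}) ->
    (forall w, f^~ w @ \oo --> F w) ->
    ((fun l => \int[P]_w (f l w)%:E) @ \oo --> \int[P]_w (F w)%:E)%E.
  move=> mf f0 nf fF.
  rewrite [X in _ --> X](_ : _ = (\int[P]_w limn (fun l => (f l w)%:E))%E); last first.
    apply: eq_integral => w _; apply/esym/cvg_lim => //.
    by apply: cvg_comp (fF w) _; exact: cvg_refl.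
  apply: (@cvg_monotone_convergence _ _ _ P setT _ (fun l w => (f l w)%:E)) => //.
  - by move=> l; exact/measurable_EFinP.
  - by move=> l w _; rewrite lee_fin.
  - by move=> w _ l k lk; rewrite lee_fin nf.
have := L v V mv v0 nv vV; have := L u U mu_ u0 nu uU.
under eq_fun do rewrite uv.
by move=> /cvg_lim <-// /cvg_lim <-.
Qed.

Let measurable_cnt l (G : {ffun {ffun 'I_l -> bool} -> nat} -> R) :
  measurable_fun setT (fun w => G (cnt l (eta w))).
Proof.
apply/measurable_EFinP.
exact: (measurable_fun_discrete (@cnt_measurable _ _ _ _ _ _ _ _ heta l) (fun c => (G c)%:E)).
Qed.

Lemma hull_moment_measurable m j : measurable_fun setT (fun w => hull_moment m j (eta w)).
Proof.
apply: (@measurable_fun_cvg _ _ _ _ (fun l w => cell_moment m j (cnt l (eta w)))).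
  by move=> l; exact: measurable_cnt.
by move=> w _; exact: cell_moment_limit.
Qed.

(** [discrete_mecke] is applied to the certified indicator times [cell_moment]: on the right the
    indicator sums to one more factor [cell_mass], on the left the limit is
    [sum_rem_hull_moment]. *)
Lemma hull_moment_shift m j :
  (\int[P]_w (hull_moment m.+1 j (eta w))%:E =
   \int[P]_w (hull_moment m j.+1 (eta w))%:E)%E.
Proof.
pose g l i (c : {ffun {ffun 'I_l -> bool} -> nat}) : R :=
  (surely_int R d i c)%:R * cell_moment m j c.
have g0 l i c : 0 <= @g l i c by rewrite mulr_ge0 ?ler0n// cell_moment_ge0.
(* The set of cells changes with [l], so monotonicity and limits in [l] are taken termwise in the
   sum over points. *)
have uE l w : \sum_i (cnt l (eta w) i)%:R * g l i (decr i (cnt l (eta w))) =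
    \sum_(x <- eta w) g l (cell l x) (cnt l (rem x (eta w))).
  rewrite sum_cnt big_seq [in RHS]big_seq; apply: eq_bigr => x xs.
  by rewrite -cnt_rem.
have gle (s : seq 'rV[R]_d) (x : 'rV[R]_d) :
    {homo (fun l => g l (cell l x) (cnt l s)) : k l / (k <= l)%N >-> k <= l}.
  move=> k l kl; rewrite /g ler_pM ?cell_moment_ge0 ?cell_moment_le//.
  rewrite ler_nat; case: (boolP (surely_int R d (cell k x) _)) => // H.
  by rewrite (surely_int_le kl H).
apply: (@eq_monotone_limit_integral
  (fun l w => \sum_i (cnt l (eta w) i)%:R * g l i (decr i (cnt l (eta w))))
  (fun l w => cell_moment m j.+1 (cnt l (eta w)))).
- move=> l; exact: (@measurable_cnt l (fun c => \sum_i (c i)%:R * g l i (decr i c))).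
- by move=> l; exact: measurable_cnt.
- by move=> l w; apply: sumr_ge0 => i _; rewrite mulr_ge0.
- by move=> l w; exact: cell_moment_ge0.
- move=> w k l kl; rewrite !uE; apply: ler_sum => x _; exact: gle.
- by move=> w; exact: cell_moment_le.
- move=> w; under eq_fun do rewrite uE.
  rewrite -sum_rem_hull_moment; apply: cvg_big => [|x _]; first exact: add_continuous.
  apply: cvgM; last exact: cell_moment_limit.
  (* The indicator is eventually 1 at an interior point by completeness, and always 0 elsewhere by
     soundness. *)
  apply: cvg_near_cst.
  have [/set_mem/surely_int_complete[l xl]|nx] := boolP (x \in int_hull (rem x (eta w))).
    by exists l => // k lk; rewrite (surely_int_le lk xl).
  exists 0%N => // k _ /=; case: (boolP (surely_int R d _ _)) => // xl.
  by case/negP: nx; apply: mem_set; exact: surely_int_sound xl.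
- by move=> w; exact: cell_moment_limit.
- move=> l; rewrite (discrete_mecke t0 heta)//; apply: eq_integral => w _.
  congr (_%:E); rewrite (_ : \sum_i _ = cell_mass (cnt l (eta w)) * cell_moment m j (cnt l (eta w))).
    by rewrite /cell_moment exprS; ring.
  by rewrite /cell_mass mulr_suml; apply: eq_bigr => i _; rewrite /g; ring.
Qed.

Lemma factorial_moment m :
  (\int[P]_w ((interior_count (eta w) ^_ m)%:R)%:E =
   \int[P]_w ((t * hull_mass (eta w)) ^+ m)%:E)%E.
Proof.
suff H j : (\int[P]_w (hull_moment m j (eta w))%:E =
    \int[P]_w (hull_moment 0 (m + j) (eta w))%:E)%E.
  have := H 0%N; rewrite addn0 /hull_moment.
  under eq_integral do rewrite expr0 mulr1.
  by under [RHS]eq_integral do rewrite ffactn0 mul1r.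
elim: m j => // m IH j.
by rewrite hull_moment_shift IH addnS.
Qed.

Lemma interior_count_measurable :
  measurable_fun setT (fun w => (interior_count (eta w))%:R : R).
Proof.
have := hull_moment_measurable 1 0; rewrite /hull_moment.
by under eq_fun do rewrite ffactn1 expr0 mulr1.
Qed.

Lemma hull_mass_measurable : measurable_fun setT (fun w => hull_mass (eta w)).
Proof.
have m := hull_moment_measurable 0 1.
rewrite (_ : (fun w => _) = (fun w => t^-1 * hull_moment 0 1 (eta w))).
  by apply: measurable_funM => //; exact: measurable_cst.
by apply/funext => w; rewrite /hull_moment ffactn0 mul1r expr1 mulKf// gt_eqF.
Qed.

End Mecke.

(** * Power series *)

Section PowerSeries.
Context {R : realType}.
Implicit Types (a b c u v : nat -> R) (r z q : R).

Definition psum a z : R := limn (pseries a z).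

Definition cvg_in a r := forall z, `|z| < r -> cvgn (pseries a z).

Lemma succ_expr_le q n : 0 <= q < 1 -> n.+1%:R * q ^+ n <= (1 - q)^-1.
Proof.
move=> /andP[q0 q1].
have : n.+1%:R * q ^+ n <= \sum_(i < n.+1) q ^+ i.
  rewrite mulr_natl -[X in _ *+ X]card_ord -sumr_const; apply: ler_sum => i _.
  by rewrite ler_wiXn2l ?(ltW q1)// -ltnS.
move=> /le_trans; apply; rewrite -[leRHS]mul1r ler_pdivlMr ?subr_gt0//.
have := subrX1 q n.+1; have := exprn_ge0 n.+1 q0.
by move: (\sum_(i < n.+1) q ^+ i) (q ^+ n.+1) => S Q; lra.
Qed.

(** With [p] halfway between [q] and 1, the bounded factor [n.+1 * (q / p) ^ n] splits off from
    [p ^ n]. *)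
Lemma succ_expr_le_geometric q : 0 <= q < 1 ->
  exists K p, [/\ 0 <= K, 0 < p, p < 1 & forall n, n.+1%:R * q ^+ n <= K * p ^+ n].
Proof.
move=> /andP[q0 q1]; pose p := (q + 1) / 2.
have p0 : 0 < p by rewrite /p; lra.
have qp : 0 <= q / p < 1.
  by rewrite divr_ge0 ?(ltW p0)//= ltr_pdivrMr// mul1r /p; lra.
exists (1 - q / p)^-1, p; split => //; first by rewrite invr_ge0 subr_ge0 ltW; case/andP: qp.
  by rewrite /p; lra.
move=> n; rewrite -ler_pdivrMr ?exprn_gt0// -mulrA -exprVn -exprMn.
exact: succ_expr_le.
Qed.

Lemma cvg_series_geometric_bound u (A q : R) : 0 <= A -> 0 <= q < 1 ->
  (forall n, `|u n| <= A * q ^+ n) -> cvgn (series u).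
Proof.
move=> A0 /andP[q0 q1] uA; apply: normed_cvg.
apply: (@series_le_cvg _ _ (geometric A q)) => //.
- by move=> n; exact: normr_ge0.
- by move=> n; rewrite /= mulr_ge0// exprn_ge0.
- by apply: is_cvg_geometric_series; rewrite ger0_norm.
Qed.

Lemma cvg_in_bound a (A q : R) : 0 <= A -> 0 < q ->
  (forall n, `|a n| <= A * q ^+ n) -> cvg_in a q^-1.
Proof.
move=> A0 q0 aA z zq; apply: (@cvg_series_geometric_bound _ A (q * `|z|)) => //.
  rewrite mulr_ge0 ?(ltW q0)//=.
  by rewrite -(mulfV (lt0r_neq0 q0)) ltr_pM2l.
move=> n; rewrite normrM normrX exprMn mulrA ler_wpM2r ?exprn_ge0//.
Qed.

Lemma cvg_in_diffs a r : cvg_in a r -> cvg_in (pseries_diffs a) r.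
Proof.
(* Convergence at the intermediate radius [y] bounds the terms there, which gives geometric decay at
   [z], strong enough to absorb the factor [n.+1]. *)
move=> ar z zr; pose y := (`|z| + r) / 2.
have z0 := normr_ge0 z.
have zy : `|z| < y by rewrite /y; lra.
have yr : y < r by rewrite /y; lra.
have y0 : 0 < y by lra.
have [M [M0 My]] : exists M, 0 <= M /\ forall n, `|a n * y ^+ n| <= M.
  have : cvgn (pseries a y) by apply: ar; rewrite gtr0_norm.
  move=> /cvg_series_bounded[K [Kreal Kf]]; exists (`|K| + 1); split.
    by rewrite addr_ge0.
  move=> n; apply: (Kf (`|K| + 1)) => //.
  by rewrite (le_lt_trans (ler_norm _))// ltrDl.
have q01 : 0 <= `|z| / y < 1.
  by rewrite divr_ge0 ?(ltW y0)//= ltr_pdivrMr// mul1r.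
have [K [p [K0 p0 p1 Kp]]] := succ_expr_le_geometric q01.
apply: (@cvg_series_geometric_bound _ (M / y * K) p).
- by rewrite mulr_ge0// divr_ge0// ltW.
- by rewrite (ltW p0).
move=> n; apply: (@le_trans _ _ (M / y * (n.+1%:R * (`|z| / y) ^+ n))); last first.
  have My0 : 0 <= M / y by rewrite divr_ge0// ltW.
  by rewrite -[leRHS]mulrA ler_wpM2l//; exact: Kp.
have := My n.+1; rewrite normrM [`|y ^+ _|]gtr0_norm ?exprn_gt0//.
rewrite -ler_pdivlMr ?exprn_gt0// => H.
have -> : M / y * (n.+1%:R * (`|z| / y) ^+ n) = n.+1%:R * (M / y ^+ n.+1) * `|z| ^+ n.
  rewrite expr_div_n exprS; field.
  by rewrite expf_neq0 gt_eqF.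
rewrite /pseries_diffs !normrM normrX ger0_norm//.
by rewrite ler_wpM2r ?exprn_ge0// ler_wpM2l.
Qed.

Lemma psum_derive a r z : cvg_in a r -> `|z| < r ->
  is_derive z (1 : R) (psum a) (psum (pseries_diffs a) z).
Proof.
move=> ar zr; pose y := (`|z| + r) / 2.
have z0 := normr_ge0 z.
have y0 : 0 <= y by rewrite /y; lra.
have yr : `|y| < r by rewrite (ger0_norm y0) /y; lra.
apply: (@pseries_snd_diffs _ _ y); last by rewrite (ger0_norm y0) /y; lra.
- exact: ar.
- exact: (cvg_in_diffs ar).
- exact: (cvg_in_diffs (cvg_in_diffs ar)).
Qed.

Lemma cvg_in_iter_diffs a r k : cvg_in a r -> cvg_in (iter k (@pseries_diffs R) a) r.
Proof. by move=> ar; elim: k => //= k; exact: cvg_in_diffs. Qed.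

Lemma psum0 a : psum a 0 = a 0%N.
Proof.
apply: cvg_lim => //; apply: cvg_near_cst; exists 1%N => // -[//|n] _ /=.
rewrite /pseries/series/= big_nat_recl//= expr0 mulr1 big1 ?addr0// => i _.
by rewrite expr0n mulr0.
Qed.

Lemma iter_pseries_diffs0 a k : iter k (@pseries_diffs R) a 0%N = k`!%:R * a k.
Proof.
elim: k a => [|k IH] a; first by rewrite mul1r.
by rewrite iterSr IH /pseries_diffs factS natrM mulrCA mulrA.
Qed.

(** The product of the partial sums exceeds the partial sum of the convolution by the coefficients
    of index N to 2N - 1 of a product of truncated polynomials. Each is at most A B (n+1) q^n, so
    this geometric tail tends to 0. *)
Lemma cauchy_product u v (A B q : R) : 0 <= A -> 0 <= B -> 0 <= q < 1 ->
  (forall n, `|u n| <= A * q ^+ n) -> (forall n, `|v n| <= B * q ^+ n) ->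
  limn (series (fun n => \sum_(k < n.+1) u k * v (n - k)%N)) =
  limn (series u) * limn (series v).
Proof.
move=> A0 B0 q01 uA vB; set w := fun n => _.
have [K [p [K0 p0 p1 Kp]]] := succ_expr_le_geometric q01.
have /andP[q0 q1] := q01.
have cu := cvg_series_geometric_bound A0 q01 uA.
have cv := cvg_series_geometric_bound B0 q01 vB.
apply: cvg_lim => //.
suff d0 : (fun N => series w N - series u N * series v N) @ \oo --> 0.
  rewrite (_ : series w = (fun N => (series w N - series u N * series v N) +
      series u N * series v N)); last by apply/funext => N; rewrite subrK.
  by rewrite -[X in _ --> X]add0r; apply: cvgD => //; exact: cvgM.
pose D := A * B * K.
have D0 : 0 <= D by rewrite !mulr_ge0.
have bnd N : `|series w N - series u N * series v N| <= D / (1 - p) * p ^+ N.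
  pose U := \poly_(i < N) u i; pose V := \poly_(i < N) v i.
  have UE : series u N = U.[1].
    by rewrite horner_poly /series/= big_mkord; apply: eq_bigr => i _; rewrite expr1n mulr1.
  have VE : series v N = V.[1].
    by rewrite horner_poly /series/= big_mkord; apply: eq_bigr => i _; rewrite expr1n mulr1.
  have sz : (size (U * V)%R <= N + N)%N.
    apply: leq_trans (size_polyMleq _ _) _; rewrite (leq_trans (leq_pred _))//.
    by rewrite leq_add// size_poly.
  rewrite UE VE -hornerM (horner_coef_wide _ sz) distrC.
  under eq_bigr do rewrite expr1n mulr1.
  rewrite -(big_mkord xpredT (fun i => (U * V)`_i)) (@big_cat_nat _ _ _ N)//= ?leq_addr//.
  have -> : \sum_(0 <= i < N) (U * V)`_i = series w N.
    rewrite /series/= big_nat [RHS]big_nat; apply: eq_bigr => n /andP[_ nN].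
    rewrite coefM; apply: eq_bigr => k _; rewrite !coef_poly.
    by rewrite (leq_ltn_trans _ nN) ?(leq_ltn_trans _ nN)// ?leq_subr// -ltnS.
  rewrite addrAC subrr add0r.
  have t n : `|(U * V)`_n| <= D * p ^+ n.
    rewrite coefM (le_trans (ler_norm_sum _ _ _))//.
    apply: (@le_trans _ _ (\sum_(k < n.+1) A * B * q ^+ n)).
      apply: ler_sum => k _; rewrite normrM !coef_poly.
      have -> : A * B * q ^+ n = (A * q ^+ k) * (B * q ^+ (n - k)).
        by rewrite mulrACA -exprD subnKC// -ltnS.
      apply: ler_pM => //; case: ifP => _ //.
        by rewrite normr0 mulr_ge0// exprn_ge0.
      by rewrite normr0 mulr_ge0// exprn_ge0.
    rewrite sumr_const card_ord -[_ *+ _]mulr_natl mulrCA /D -mulrA ler_wpM2l ?mulr_ge0//.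
  rewrite (le_trans (ler_norm_sum _ _ _))//.
  apply: (@le_trans _ _ (\sum_(N <= i < N + N) D * p ^+ i)); first exact: ler_sum.
  rewrite -mulr_sumr -[D / _ * _]mulrA ler_wpM2l//.
  have -> : \sum_(N <= i < N + N) p ^+ i = p ^+ N * \sum_(i < N) p ^+ i.
    rewrite -{1}[N]add0n big_addn addnK big_mkord mulr_sumr.
    by apply: eq_bigr => i _; rewrite addnC exprD.
  rewrite mulrC ler_wpM2r ?exprn_ge0 ?(ltW p0)//.
  rewrite -[leRHS]mul1r ler_pdivlMr ?subr_gt0//.
  have := subrX1 p N; have := exprn_ge0 N (ltW p0).
  by move: (\sum_(i < N) p ^+ i) (p ^+ N) => S Q; lra.
apply/cvgr0Pnorm_lt => e e0.
have /cvgr0Pnorm_lt/(_ _ e0) : geometric (D / (1 - p)) p @ \oo --> 0.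
  by apply: cvg_geometric; rewrite gtr0_norm.
apply: filterS => N /=; apply: le_lt_trans.
by rewrite (le_trans (bnd N))// ler_norm.
Qed.

End PowerSeries.

(** * The logarithm of a power series *)

Section LogSeries.
Context {R : realType}.
Implicit Types (a : nat -> R) (r z : R).

(** Each coefficient depends on all earlier ones, so the recursion carries their list. *)
Definition logder_prefix a n : seq R :=
  iteri n (fun k s => rcons s (k.+1%:R * a k.+1 - \sum_(i < k) s`_i * a (k - i)%N)) [::].

(* The coefficients of A' / A for the power series A with coefficients a, a_0 = 1. *)
Definition logder a n : R := (logder_prefix a n.+1)`_n.

Lemma size_logder_prefix a n : size (logder_prefix a n) = n.
Proof. by elim: n => //= n IH; rewrite size_rcons IH. Qed.

Lemma nth_logder_prefix a n i : (i < n)%N -> (logder_prefix a n)`_i = logder a i.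
Proof.
elim: n => // n IH; rewrite ltnS leq_eqVlt => /orP[/eqP -> //|/[dup] i_n /IH <-].
by rewrite /= nth_rcons size_logder_prefix i_n.
Qed.

Lemma logderE a n : logder a n = n.+1%:R * a n.+1 - \sum_(i < n) logder a i * a (n - i)%N.
Proof.
rewrite {1}/logder /= nth_rcons size_logder_prefix ltnn eqxx; congr (_ - _).
by apply: eq_bigr => i _; rewrite nth_logder_prefix.
Qed.

Lemma logder_mul a n : a 0%N = 1 ->
  \sum_(k < n.+1) logder a k * a (n - k)%N = pseries_diffs a n.
Proof.
move=> a0; rewrite big_ord_recr /= subnn a0 mulr1 [X in _ + X]logderE.
by rewrite addrC subrK.
Qed.

(** Each of the two parts of [logderE] is at most A rho^n for rho = 2A + 2: the leading one because
    n + 1 <= 2^n <= rho^n, the sum because rho - 1 = 2A + 1 turns 2A times the geometric sum into at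
    most rho^n. *)
Lemma logder_bound a (A : R) n : 1 <= A -> (forall n, `|a n| <= A) ->
  `|logder a n| <= 2 * A * (2 * A + 2) ^+ n.
Proof.
move=> A1 aA; have A0 : 0 <= A by lra.
elim/ltn_ind: n => n IH; rewrite logderE.
set rho := 2 * A + 2; have r2 : 2 <= rho by rewrite /rho; lra.
have rn0 : 0 <= rho ^+ n by rewrite exprn_ge0; lra.
rewrite (le_trans (ler_normB _ _))//.
have -> : 2 * A * rho ^+ n = A * rho ^+ n + A * rho ^+ n by ring.
apply: lerD.
  rewrite normrM ger0_norm// mulrC ler_pM//.
  have : (n.+1 <= 2 ^ n)%N by exact: ltn_expl.
  rewrite -(ler_nat R) natrX => /le_trans; apply.
  by rewrite lerXn2r ?nnegrE//; lra.
rewrite (le_trans (ler_norm_sum _ _ _))//.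
apply: (@le_trans _ _ (\sum_(i < n) 2 * A * A * rho ^+ i)).
  apply: ler_sum => i _; rewrite normrM mulrAC ler_pM//.
  exact: IH.
rewrite -mulr_sumr; set S := \sum_(i < n) _.
have S0 : 0 <= S by apply: sumr_ge0 => i _; rewrite exprn_ge0; lra.
have E : rho ^+ n - 1 = (2 * A + 1) * S by rewrite subrX1 /rho; congr (_ * _); ring.
have -> : 2 * A * A * S = A * (2 * A * S) by ring.
by rewrite ler_wpM2l//; move: E; rewrite mulrDl; lra.
Qed.

Lemma is_derive0_const (f : R -> R) r z :
  (forall x : R, `|x| < r -> is_derive x (1 : R) f 0) -> `|z| < r -> f z = f 0.
Proof.
move=> f0 zr.
have r0 : 0 < r by exact: le_lt_trans zr.
have D x y : x <= y -> `|x| < r -> `|y| < r -> f x = f y.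
  move=> xy; rewrite !ltr_norml => /andP[x1 x2] /andP[y1 y2].
  have fd u : x <= u <= y -> is_derive u (1 : R) f 0.
    by move=> /andP[u1 u2]; apply: f0; rewrite ltr_norml; apply/andP; split; lra.
  have [||c _ /eqP] := @MVT_segment R f (fun=> 0) x y xy.
  - by move=> u; rewrite in_itv/= => /andP[u1 u2]; apply: fd; rewrite !ltW.
  - apply: derivable_within_continuous => u; rewrite in_itv/= => /fd.
    by move=> h; exact: ex_derive.
  by rewrite mul0r subr_eq0 => /eqP.
have [z0|z0] := leP 0 z; first by apply/esym/D => //; rewrite normr0.
by apply: D => //; rewrite ?normr0// ltW.
Qed.

(** With C = A'/A as a power series and B its termwise antiderivative vanishing at 0, A exp(-B) has
    derivative (A' - C A) exp(-B) = 0, so A = exp B within the radius given by [logder_bound]. *)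
Lemma ln_psum a (A : R) : a 0%N = 1 -> (forall n, `|a n| <= A) ->
  exists b r, [/\ 0 < r, b 0%N = 0 &
    forall z, `|z| < r -> pseries b z @ \oo --> ln (psum a z)].
Proof.
move=> a0 aA.
have A1 : 1 <= A by have := aA 0%N; rewrite a0 normr1.
have A0 : 0 <= A by lra.
pose rho := 2 * A + 2; have rho0 : 0 < rho by rewrite /rho; lra.
have cA n := logder_bound n A1 aA; set c := logder a in cA.
pose b n := if n is m.+1 then c m / m.+1%:R else 0.
have bA n : `|b n| <= 2 * A * rho ^+ n.
  case: n => [|n] /=; first by rewrite normr0 expr0; lra.
  rewrite normrM normfV normr_nat; apply: (@le_trans _ _ `|c n|).
    by rewrite ler_piMr// invf_le1// ler1n.
  rewrite (le_trans (cA n))// ler_wpM2l//; first lra.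
  by rewrite ler_weXn2l//; rewrite -/rho /rho; lra.
have A2 : 0 <= 2 * A by lra.
have bin := cvg_in_bound A2 rho0 bA.
have aA' n : `|a n| <= A * rho ^+ n.
  rewrite (le_trans (aA n))// ler_peMr// exprn_ege1// /rho; lra.
have ain := cvg_in_bound A0 rho0 aA'.
have bd : pseries_diffs b = c.
  by apply/funext => n; rewrite /pseries_diffs /b mulrC divfK// pnatr_eq0.
have ode z : `|z| < rho^-1 -> psum (pseries_diffs a) z = psum c z * psum a z.
  move=> zr; rewrite /psum -(@cauchy_product _ _ _ (2 * A) A (rho * `|z|))//.
  - congr (limn _); rewrite /pseries; congr series; apply/funext => n.
    rewrite /= -(logder_mul _ a0) mulr_suml; apply: eq_bigr => k _.
    rewrite mulrACA -exprD subnKC// -ltnS//.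
  - rewrite mulr_ge0 ?(ltW rho0)//=.
    by rewrite -(mulfV (lt0r_neq0 rho0)) ltr_pM2l.
  - by move=> n; rewrite normrM normrX exprMn mulrA ler_wpM2r ?exprn_ge0.
  - by move=> n; rewrite normrM normrX exprMn mulrA ler_wpM2r ?exprn_ge0.
have sol z : `|z| < rho^-1 -> psum a z = expR (psum b z).
  move=> zr; pose f x := psum a x * expR (- psum b x).
  have : f z = f 0.
    apply: (@is_derive0_const _ rho^-1) => // x xr.
    have da := psum_derive ain xr; have db := psum_derive bin xr.
    rewrite bd in db.
    have de : is_derive x (1 : R) (fun y => expR (- psum b y)) (expR (- psum b x) * - psum c x).
      exact: (@is_derive1_comp _ expR (- psum b) _ _ _ (is_derive_expR _) (is_deriveN db)).
    have dm := is_deriveM da de.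
    have dE : psum a x *: (expR (- psum b x) * - psum c x) +
        expR (- psum b x) *: psum (pseries_diffs a) x = 0.
      by rewrite ode// /GRing.scale/=; ring.
    rewrite -dE; exact: dm.
  have En : expR (psum b z) != 0 by rewrite gt_eqF ?expR_gt0.
  rewrite /f !psum0 a0 /= oppr0 expR0 mulr1 expRN => h.
  by rewrite -[LHS](divfK En) h mul1r.
exists b, rho^-1; split => //; first by rewrite invr_gt0.
by move=> z zr; rewrite sol// expRK; exact: bin.
Qed.

End LogSeries.

(** * Exponential moments *)

Section ExponentialMoments.
Context {R : realType} {dT : measure_display} {T : measurableType dT}.
Context (P : probability T R).

Lemma expR_nneseries (x : R) : 0 <= x ->
  ((expR x)%:E = \sum_(0 <= m <oo) (x ^+ m / m`!%:R)%:E)%E.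
Proof.
move=> x0; apply/esym/cvg_lim => //.
rewrite (_ : (fun n => _) = EFin \o series (exp_coeff x)).
  by apply: cvg_EFin; [exact: nearW|exact: is_cvg_series_exp_coeff].
by apply/funext => n /=; rewrite sumEFin.
Qed.

(** The binomial theorem for (1 + s)^n; the falling factorials vanish beyond m = n. *)
Lemma natexp_nneseries (s : R) (n : nat) : 0 <= s ->
  ((expR (ln (1 + s) * n%:R))%:E =
   \sum_(0 <= m <oo) ((s ^+ m / m`!%:R) * (n ^_ m)%:R)%:E)%E.
Proof.
move=> s0; rewrite expRM_natr lnK; last by rewrite posrE; lra.
apply/esym/cvg_lim => //; apply: cvg_near_cst; exists n.+1 => // N /= nN.
rewrite sumEFin; congr (_%:E).
rewrite (@big_cat_nat _ _ _ n.+1)//= [X in _ + X]big_nat_cond [X in _ + X]big1 ?addr0; last first.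
  by move=> i /andP[/andP[ni _] _]; rewrite ffact_small// mulr0.
rewrite big_mkord exprDn; apply: eq_bigr => i _.
rewrite expr1n mul1r -bin_ffact natrM -[RHS]mulr_natr; field.
by rewrite pnatr_eq0 -lt0n fact_gt0.
Qed.

(** Since [s] is nonnegative both expansions have nonnegative terms, so sum and integral commute
    even if the values are infinite. *)
Lemma expectation_exp_transfer (I : T -> nat) (X : T -> R) (s : R) :
  measurable_fun setT (fun w => (I w)%:R : R) -> measurable_fun setT X ->
  (forall w, 0 <= X w) ->
  (forall m, \int[P]_w ((I w ^_ m)%:R)%:E = \int[P]_w (X w ^+ m)%:E)%E ->
  0 <= s ->
  (\int[P]_w (expR (ln (1 + s) * (I w)%:R))%:E = \int[P]_w (expR (s * X w))%:E)%E.
Proof.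
move=> mI mX X0 IX s0.
have mIk k : measurable (I @^-1` [set k]).
  rewrite (_ : I @^-1` [set k] = setT `&` (fun w => (I w)%:R : R) @^-1` [set k%:R]).
    by apply: mI => //; exact: measurable_set1.
  rewrite setTI; apply/seteqP; split => w /= [].
    by move=> ->.
  by move=> /eqP; rewrite eqr_nat => /eqP.
have c0 m : 0 <= s ^+ m / m`!%:R by rewrite divr_ge0// exprn_ge0.
have mF m : measurable_fun setT (fun w => ((I w ^_ m)%:R : R)%:E).
  exact: (measurable_fun_discrete mIk (fun k => ((k ^_ m)%:R : R)%:E)).
have mG m : measurable_fun setT (fun w => (X w ^+ m)%:E).
  by apply/measurable_EFinP; exact: measurable_funX.
under eq_integral do rewrite natexp_nneseries//.
rewrite integral_nneseries//; last 2 first.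
- move=> m; apply/measurable_EFinP.
  by apply: measurable_funM => //; apply/measurable_EFinP; exact: mF.
- by move=> m w _; rewrite lee_fin mulr_ge0.
have E w : ((expR (s * X w))%:E = \sum_(0 <= m <oo) ((s ^+ m / m`!%:R) * X w ^+ m)%:E)%E.
  rewrite expR_nneseries ?mulr_ge0//; apply: eq_eseriesr => m _.
  by rewrite exprMn mulrAC.
under [RHS]eq_integral do rewrite E.
rewrite integral_nneseries//; last 2 first.
- move=> m; apply/measurable_EFinP; apply: measurable_funM => //.
  exact: measurable_funX.
- by move=> m w _; rewrite lee_fin mulr_ge0// exprn_ge0.
apply: eq_eseriesr => m _.
under eq_integral do rewrite EFinM.
under [RHS]eq_integral do rewrite EFinM.
rewrite !ge0_integralZl_EFin// ?IX//.
by move=> w _; rewrite lee_fin exprn_ge0.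
Qed.

Lemma expR_coeff_le (x : R) n : 0 <= x -> series (exp_coeff x) n <= expR x.
Proof.
move=> x0; apply: nondecreasing_cvgn_le; last exact: is_cvg_series_exp_coeff.
by apply: nondecreasing_series => k _ _; exact: exp_coeff_ge0.
Qed.

(** For |z| < 1 the partial sums of exp(zX) are dominated by exp X, and so is each X^n / n!, which
    bounds the coefficients by E exp X. *)
Lemma cvg_exp_moments (X : T -> R) :
  measurable_fun setT X -> (forall w, 0 <= X w) ->
  (\int[P]_w (expR (X w))%:E < +oo)%E ->
  exists a : nat -> R, exists A : R, [/\ a 0%N = 1, (forall n, `|a n| <= A) &
    forall z, `|z| < 1 -> P.-integrable setT (fun w => (expR (z * X w))%:E) /\
      psum a z = fine (\int[P]_w (expR (z * X w))%:E)].
Proof.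
move=> mX X0 Xoo.
have iX : P.-integrable setT (fun w => (expR (X w))%:E).
  apply/integrableP; split.
    by apply/measurable_EFinP; exact: measurableT_comp.
  by under eq_integral do rewrite gee0_abs ?lee_fin ?expR_ge0//.
have mc n : measurable_fun setT (fun w => exp_coeff (X w) n).
  by apply: measurable_funM => //; exact: measurable_funX.
have cle n w : exp_coeff (X w) n <= expR (X w).
  apply: le_trans (expR_coeff_le n.+1 (X0 w)).
  by rewrite /series/= big_nat_recr//= lerDr sumr_ge0// => i _; exact: exp_coeff_ge0.
have ic n : P.-integrable setT (fun w => (exp_coeff (X w) n)%:E).
  apply: le_integrable iX => //; first exact/measurable_EFinP.
  move=> w _; rewrite lee_fin !ger0_norm ?expR_ge0//; exact: exp_coeff_ge0.
exists (fun n => fine (\int[P]_w (exp_coeff (X w) n)%:E)), (fine (\int[P]_w (expR (X w))%:E)).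
split.
- rewrite (_ : (fun w => _) = cst 1%E); last first.
    by apply/funext => w; rewrite /exp_coeff/= expr0 fact0 divr1.
  by rewrite integral_cst// mul1e; exact: (congr1 fine (@probability_setT _ _ _ P)).
- move=> n; rewrite ger0_norm; last first.
    by rewrite fine_ge0// integral_ge0// => w _; rewrite lee_fin exp_coeff_ge0.
  apply: fine_le; [exact: integrable_fin_num|exact: integrable_fin_num|].
  apply: ge0_le_integral => //.
  + by move=> w _; rewrite lee_fin exp_coeff_ge0.
  + by apply/measurable_EFinP; exact: mc.
  + by apply/measurable_EFinP; exact: measurableT_comp.
  + by move=> w _; rewrite lee_fin cle.
move=> z z1.
have mz : measurable_fun setT (fun w => (expR (z * X w))%:E).
  apply/measurable_EFinP; apply: measurableT_comp => //.
  by apply: measurable_funM.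
have iz : P.-integrable setT (fun w => (expR (z * X w))%:E).
  apply: le_integrable iX => // w _; rewrite lee_fin !ger0_norm ?expR_ge0//.
  rewrite ler_expR -[leRHS]mul1r ler_wpM2r//.
  by rewrite (le_trans (ler_norm _))// ltW.
split => //; apply: cvg_lim => //.
pose f N w := (series (exp_coeff (z * X w)) N)%:E.
have fE N : (\int[P]_w f N w)%E =
    (pseries (fun n => fine (\int[P]_w (exp_coeff (X w) n)%:E)) z N)%:E.
  rewrite /f /series/=; under eq_integral do rewrite -sumEFin.
  rewrite integral_sum//; last first.
    move=> n; rewrite (_ : (fun w => _) = (fun w => (z ^+ n)%:E * (exp_coeff (X w) n)%:E)%E).
      exact: integrableZl.
    by apply/funext => w; rewrite -EFinM /exp_coeff/= exprMn mulrA.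
  rewrite /pseries /series/= -sumEFin; apply: eq_bigr => n _.
  rewrite EFinM fineK ?integrable_fin_num// muleC -integralZl//.
  by apply: eq_integral => w _; rewrite -EFinM /exp_coeff/= exprMn mulrA.
rewrite (_ : pseries _ z = fine \o (fun N => \int[P]_w f N w)%E); last first.
  by apply/funext => N /=; rewrite fE.
apply: fine_cvg; rewrite fineK ?integrable_fin_num//.
apply: (@dominated_cvg _ _ _ P setT _ f _ (fun w => (expR (X w))%:E)) => //.
- move=> N; apply/measurable_EFinP; apply: measurable_sum => n.
  apply: measurable_funM => //; apply: measurable_funX.
  exact: measurable_funM.
- move=> w _; apply: cvg_EFin; first exact: nearW.
  exact: is_cvg_series_exp_coeff.
- move=> N w _; rewrite lee_fin (le_trans (ler_norm_sum _ _ _))//.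
  apply: le_trans (expR_coeff_le N (X0 w)); rewrite /series/=.
  apply: ler_sum => n _; rewrite /exp_coeff/= normrM [`|_^-1|]ger0_norm ?invr_ge0//.
  rewrite ler_wpM2r ?invr_ge0// normrX lerXn2r ?nnegrE//.
  rewrite normrM (ger0_norm (X0 w)) ler_piMl// ltW//.
Qed.

End ExponentialMoments.

(** * Cumulants *)

Section Cumulants.
Context {R : realType}.
Implicit Types (kappa : nat -> R) (z s t : R).

Definition cumulant_coef kappa k : R := if k is 0 then 0 else kappa k / k`!%:R.

Lemma cumulant_seriesE kappa z n :
  \sum_(1 <= k < n) kappa k * z ^+ k / (k`!)%:R = pseries (cumulant_coef kappa) z n.
Proof.
case: n => [|n]; rewrite /pseries/series/=; first by rewrite !big_geq.
rewrite [RHS]big_ltn// mul0r add0r big_nat [RHS]big_nat; apply: eq_bigr => -[//|k] _.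
by rewrite /= mulrAC.
Qed.

Lemma cumulant_seq_exists {dT} {T : measurableType dT} (P : probability T R) (X : T -> R) :
  measurable_fun setT X -> (forall w, 0 <= X w) ->
  (\int[P]_w (expR (X w))%:E < +oo)%E -> exists kappa, is_cumulant_seq P X kappa.
Proof.
move=> mX X0 Xoo; have [a [A [a0 aA aX]]] := cvg_exp_moments mX X0 Xoo.
have [b [r [r0 b0 br]]] := ln_psum a0 aA.
exists (fun k => k`!%:R * b k); split => //.
exists (Num.min r 1); split; first by rewrite lt_min r0 ltr01.
move=> z; rewrite lt_min => /andP[zr z1]; have [iz <-] := aX z z1; split => //.
under eq_fun do rewrite cumulant_seriesE.
rewrite (_ : (fun n => _) = pseries b z); first exact: br.
apply/funext => n; apply: eq_bigr => -[|k] _; first by rewrite /= b0.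
by congr (_ * _); rewrite /cumulant_coef mulrAC mulfV ?mul1r// pnatr_eq0 -lt0n fact_gt0.
Qed.

Lemma cumulant_seq_psum {dT} {T : measurableType dT} (P : probability T R) (X : T -> R) kappa :
  is_cumulant_seq P X kappa -> exists2 r, 0 < r &
    cvg_in (cumulant_coef kappa) r /\ forall z, `|z| < r ->
    psum (cumulant_coef kappa) z = ln (fine (\int[P]_w (expR (z * X w))%:E)).
Proof.
move=> [_ [r [r0 rP]]]; exists r => //.
have H z : `|z| < r -> pseries (cumulant_coef kappa) z @ \oo -->
    ln (fine (\int[P]_w (expR (z * X w))%:E)).
  move=> /rP[_]; under eq_fun do rewrite cumulant_seriesE.
  exact.
by split=> z /H; [apply: cvgP|move/cvg_lim; apply].
Qed.

Lemma stirling10 j : stirling1 0 j = (j == 0%N)%:R.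
Proof. by rewrite /stirling1 big_ord0 coef1. Qed.

Lemma stirling1S n j :
  stirling1 n.+1 j = (if j is i.+1 then stirling1 n i else 0) - stirling1 n j * n%:Z.
Proof.
rewrite /stirling1 big_ord_recr/= mulrBr coefB coefMX coefMC.
by case: j.
Qed.

Lemma stirling1_gt n j : (n < j)%N -> stirling1 n j = 0.
Proof.
elim: n j => [|n IH] j nj; first by rewrite stirling10; case: j nj.
by rewrite stirling1S; case: j nj => // j nj; rewrite !IH ?mul0r ?subr0// ltnW.
Qed.

(** The Stirling recurrence in the form met when differentiating: the shift of [K] stands for a
    derivative in u = ln(1 + s). *)
Lemma stirling1_sumS (K : nat -> R) n :
  \sum_(j < n.+2) (stirling1 n.+1 j)%:~R * K j =
  \sum_(j < n.+1) (stirling1 n j)%:~R * K j.+1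
    - n%:R * \sum_(j < n.+1) (stirling1 n j)%:~R * K j.
Proof.
under eq_bigr do rewrite stirling1S rmorphB rmorphM/= mulrBl.
rewrite sumrB; congr (_ - _).
  by rewrite big_ord_recl/= mul0r add0r.
rewrite big_ord_recr/= (stirling1_gt (ltnSn n)) !mul0r addr0 mulr_sumr.
by apply: eq_bigr => j _; rewrite mulrAC mulrC mulrA.
Qed.

Lemma is_derive_ln1D (s : R) : 0 <= s ->
  is_derive s (1 : R) (fun x : R => ln (1 + x)) (1 + s)^-1.
Proof.
move=> s0; have d1 : is_derive s (1 : R) (fun x : R => 1 + x) 1.
  have := is_deriveD (is_derive_cst (1 : R) s 1) (is_derive_id s (1 : R)).
  by rewrite add0r.
have d2 : is_derive (1 + s) (1 : R) (@ln R) (1 + s)^-1.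
  by apply: is_derive1_ln; lra.
have := is_derive1_comp d2 d1; by rewrite mulr1.
Qed.

End Cumulants.

(** * Comparing the derivatives of the two series at 0 *)

Section CumulantRelation.
Context {R : realType}.
Context (aI am : nat -> R) (rI rm t s0 : R).
Hypotheses (rI0 : 0 < rI) (rm0 : 0 < rm) (t0 : 0 < t) (s00 : 0 < s0).
Hypotheses (aIr : cvg_in aI rI) (amr : cvg_in am rm).
Hypothesis amI : forall s : R, 0 <= s < s0 -> psum am (t * s) = psum aI (ln (1 + s)).

Let D (a : nat -> R) k := psum (iter k (@pseries_diffs R) a).
(** (1 + s)^k times the k-th derivative in s of am(t s). With u = ln(1 + s) and E = d/du this
    operator is E (E - 1) ... (E - k + 1), whose expansion in powers of E, applied to aI(u), is
    [rhs]. *)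
Let lhs k (s : R) := (1 + s) ^+ k * (t ^+ k * D am k (t * s)).
Let rhs k (s : R) := \sum_(j < k.+1) (stirling1 k j)%:~R * D aI j (ln (1 + s)).
Let s1 := Num.min s0 (Num.min rI (rm / t)).

Let derD a r k (z : R) : cvg_in a r -> `|z| < r ->
  is_derive z (1 : R) (D a k) (D a k.+1 z).
Proof. by move=> ar; apply: psum_derive; exact: cvg_in_iter_diffs. Qed.

Let is_derive_lhs k (s : R) : 0 <= s < s1 -> is_derive s (1 : R) (lhs k)
  (k%:R * (1 + s) ^+ k.-1 * (t ^+ k * D am k (t * s)) +
   (1 + s) ^+ k * (t ^+ k.+1 * D am k.+1 (t * s))).
Proof.
move=> /andP[ge0]; rewrite !lt_min => /and3P[_ _ sr].
have ts : `|t * s| < rm.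
  by rewrite ger0_norm ?mulr_ge0 ?(ltW t0)// mulrC -ltr_pdivlMr.
have dt : is_derive s (1 : R) (fun x : R => t * x) t.
  have h := is_deriveZ t (is_derive_id s (1 : R)).
  by rewrite /GRing.scale/= mulr1 in h.
have dD : is_derive s (1 : R) (fun x : R => t ^+ k * D am k (t * x))
    (t ^+ k.+1 * D am k.+1 (t * s)).
  have h := is_deriveZ (t ^+ k) (is_derive1_comp (derD k amr ts) dt).
  by apply: is_derive_eq h _; rewrite /GRing.scale/= exprS; ring.
have d1 : is_derive s (1 : R) (fun x : R => 1 + x) 1.
  have := is_deriveD (is_derive_cst (1 : R) s 1) (is_derive_id s (1 : R)).
  by rewrite add0r.
have dp : is_derive s (1 : R) (fun x : R => (1 + x) ^+ k) (k%:R * (1 + s) ^+ k.-1).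
  have h := is_deriveX k d1; rewrite /GRing.scale/= mulr1 in h.
  have -> : (fun x : R => (1 + x) ^+ k) = (fun x : R => 1 + x) ^+ k.
    by apply/funext => x; rewrite exprfctE.
  exact: h.
have h := is_deriveM dp dD; apply: is_derive_eq h _.
by rewrite /GRing.scale/= addrC mulrC [X in _ + X]mulrC.
Qed.

Let is_derive_rhs k (s : R) : 0 <= s < s1 -> is_derive s (1 : R) (rhs k)
  ((\sum_(j < k.+1) (stirling1 k j)%:~R * D aI j.+1 (ln (1 + s))) / (1 + s)).
Proof.
move=> /andP[ge0]; rewrite !lt_min => /and3P[_ sr _].
have lr : `|ln (1 + s)| < rI.
  rewrite ger0_norm; last by rewrite ln_ge0//; lra.
  by apply: le_lt_trans sr; apply: le_ln1Dx; lra.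
have h (j : 'I_k.+1) : is_derive s (1 : R)
    (fun x : R => (stirling1 k j)%:~R * D aI j (ln (1 + x)))
    ((stirling1 k j)%:~R * (D aI j.+1 (ln (1 + s)) / (1 + s))).
  have hj := is_deriveZ ((stirling1 k j)%:~R : R)
    (@is_derive1_comp _ (D aI j) (fun x => ln (1 + x)) s _ _ (derD j aIr lr) (is_derive_ln1D ge0)).
  exact: hj.
have := is_derive_sum h.
rewrite (_ : \sum_(j < k.+1) _ = rhs k); last by apply/funext => x; rewrite fct_sumE.
by move=> H; apply: is_derive_eq H _; rewrite mulr_suml; apply: eq_bigr => j _; rewrite mulrA.
Qed.

(** Both sides obey F_(k+1) = (1 + s) F_k' - k F_k. The interval is open because equality of
    derivatives needs equality in a neighbourhood, and [amI] gives nothing for s < 0. *)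
Let lhs_rhs k (s : R) : 0 < s < s1 -> lhs k s = rhs k s.
Proof.
elim: k s => [|k IH] s /andP[sgt0 slt].
  have -> : rhs 0 s = D aI 0 (ln (1 + s)).
    by rewrite /rhs big_ord_recl big_ord0 stirling10 addr0 mul1r.
  rewrite /lhs !expr0 !mul1r.
  by apply: amI; rewrite (ltW sgt0)/=; move: slt; rewrite lt_min => /andP[].
have s01 : 0 <= s < s1 by rewrite (ltW sgt0).
have dl := is_derive_lhs k s01; have dr := is_derive_rhs k s01.
have E : 'D_1 (lhs k) s = 'D_1 (rhs k) s.
  apply: near_eq_derive.
  have : \forall x \near s, x \in `]0, s1[.
    by apply: near_in_itvoo; rewrite in_itv/= sgt0 slt.
  by apply: filterS => x; rewrite in_itv/=; exact: IH.
have s1n : 1 + s != 0 by rewrite gt_eqF//; lra.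
move: E; rewrite !derive_val => E.
rewrite /rhs (stirling1_sumS (fun j => D aI j (ln (1 + s)))).
rewrite -/(rhs k s) -IH ?sgt0//.
have -> : \sum_(j < k.+1) (stirling1 k j)%:~R * D aI j.+1 (ln (1 + s)) =
   (1 + s) * ((\sum_(j < k.+1) (stirling1 k j)%:~R * D aI j.+1 (ln (1 + s))) / (1 + s)).
  by rewrite mulrCA mulfV// mulr1.
rewrite -E /lhs; case: (k) => [|n] /=; first by rewrite !expr0 expr1; ring.
by rewrite !exprS; ring.
Qed.

(** At 0 both sides reduce to coefficients. They are known to agree only for s > 0, so 0 is reached
    as a right limit, with continuity from derivability. *)
Lemma cumulant_coef_relation k :
  t ^+ k * (k`!%:R * am k) = \sum_(j < k.+1) (stirling1 k j)%:~R * (j`!%:R * aI j).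
Proof.
have s1p : 0 < s1 by rewrite !lt_min s00 rI0 divr_gt0.
have s01 : 0 <= (0 : R) < s1 by rewrite lexx.
have l0 : lhs k 0 = t ^+ k * (k`!%:R * am k).
  by rewrite /lhs mulr0 addr0 expr1n mul1r /D psum0 iter_pseries_diffs0.
have r0 : rhs k 0 = \sum_(j < k.+1) (stirling1 k j)%:~R * (j`!%:R * aI j).
  rewrite /rhs addr0 ln1; apply: eq_bigr => j _.
  by rewrite /D psum0 iter_pseries_diffs0.
rewrite -l0 -r0.
have cont (f : R -> R) (df : R) : is_derive (0 : R) (1 : R) f df -> f x @[x --> 0^'+] --> f 0.
  move=> [/derivable1_diffP/differentiable_continuous fc _].
  by apply: cvg_at_right_filter; exact: fc.
have cl := cont _ _ (is_derive_lhs k s01); have cr := cont _ _ (is_derive_rhs k s01).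
apply: (@cvg_unique _ (@Rhausdorff R) (lhs k x @[x --> 0^'+])) => //.
apply: cvg_trans cr; apply: near_eq_cvg.
have pos : \forall x \near (0 : R)^'+, 0 < x by exact: nbhs_right_gt.
have small : \forall x \near (0 : R)^'+, x < s1 by exact: nbhs_right_lt.
by apply: filterS2 pos small => x x0 x1; apply/esym/lhs_rhs; rewrite x0.
Qed.

End CumulantRelation.

Section BoundedExp.
Context {R : realType} {dT : measure_display} {T : measurableType dT}.

Lemma bounded_exp_integral (P : probability T R) (X : T -> R) (M : R) :
  measurable_fun setT X -> (forall w, X w <= M) ->
  (\int[P]_w (expR (X w))%:E < +oo)%E.
Proof.
move=> mX XM; apply: (@le_lt_trans _ _ (\int[P]_w (cst (expR M)%:E w))%E).
  apply: ge0_le_integral => //.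
  - by apply/measurable_EFinP; exact: measurableT_comp.
  - by move=> w _; rewrite lee_fin ler_expR.
by rewrite integral_cst// lte_mul_pinfty ?lee_fin ?expR_ge0// ltey_eq fin_num_measure.
Qed.

Lemma factM_cumulant_coef (kappa : nat -> R) k : (0 < k)%N ->
  k`!%:R * cumulant_coef kappa k = kappa k.
Proof.
by case: k => // k _; rewrite /cumulant_coef mulrC divfK// pnatr_eq0 -lt0n fact_gt0.
Qed.

End BoundedExp.

Theorem theorem3 (R : realType) (d : nat) (hd : (0 < d)%N)
  (dT : measure_display) (T : measurableType dT) (P : probability T R)
  (mu : probability (Rd R d) R) (hmu : abs_cont_leb mu)
  (t : R) (ht : 0 < t) (eta : T -> seq 'rV[R]_d)
  (heta : poisson_pp P t mu eta) :
  let muPi := fun w => fine (mu (conv_hull (eta w))) in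
  let IPi := fun w => ((interior_count (eta w))%:R : R) in
  [/\ (exists kappa, is_cumulant_seq P muPi kappa),
      (exists kappa, is_cumulant_seq P IPi kappa) &
      forall kmu kI : nat -> R,
        is_cumulant_seq P muPi kmu -> is_cumulant_seq P IPi kI ->
        forall k : nat, (1 <= k)%N ->
          t ^+ k * kmu k = \sum_(1 <= j < k.+1) (stirling1 k j)%:~R * kI j].
Proof.
move=> muPi IPi.
have hullE : muPi = fun w => hull_mass mu (eta w).
  by apply/funext => w; rewrite /muPi abs_cont_conv_hull.
have mmu : measurable_fun setT muPi.
  by rewrite hullE; exact: (hull_mass_measurable ht heta).
have mI : measurable_fun setT IPi := interior_count_measurable heta.
have mu0 w : 0 <= muPi w by exact: fine_ge0.
have mu1 w : muPi w <= 1.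
  have m := int_hull_measurable (eta w).
  by rewrite hullE /hull_mass -lee_fin fineK ?fin_num_measure// probability_le1.
have mX : measurable_fun setT (fun w => t * muPi w) by exact: measurable_funM.
have transfer s : 0 <= s ->
    (\int[P]_w (expR (ln (1 + s) * IPi w))%:E = \int[P]_w (expR (s * (t * muPi w)))%:E)%E.
  move=> s0; apply: expectation_exp_transfer => //.
    by move=> w; rewrite mulr_ge0// ltW.
  by move=> m; rewrite hullE (factorial_moment hd ht heta).
split.
- apply: cumulant_seq_exists => //.
  exact: bounded_exp_integral mmu mu1.
- apply: cumulant_seq_exists => //.
  (* At s = e - 1, where ln(1 + s) = 1, the transfer identity bounds E exp(I) through the bounded
     variable [muPi]. *)
  have e1 : 0 <= expR 1 - 1 :> R by rewrite subr_ge0 -expR0 ler_expR.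
  have := transfer _ e1; rewrite addrC subrK expRK.
  under eq_integral do rewrite mul1r.
  move=> ->; apply: (@bounded_exp_integral _ _ _ _ _ ((expR 1 - 1) * t)).
    exact: measurable_funM.
  by move=> w; rewrite ler_wpM2l// ler_piMr// ltW.
move=> kmu kI /cumulant_seq_psum[rm rm0 [cm pm]] /cumulant_seq_psum[rI rI0 [cI pI]] k k0.
(* For s < s0 both arguments are within the radii of convergence, as ln(1 + s) <= s < rI and t s <
   rm. *)
pose s0 := Num.min rI (rm / t).
have s00 : 0 < s0 by rewrite lt_min rI0 divr_gt0.
have rel s : 0 <= s < s0 ->
    psum (cumulant_coef kmu) (t * s) = psum (cumulant_coef kI) (ln (1 + s)).
  move=> /andP[sge0]; rewrite lt_min => /andP[sI sm].
  rewrite pm; last by rewrite ger0_norm ?mulr_ge0 ?(ltW ht)// mulrC -ltr_pdivlMr.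
  rewrite pI; last first.
    rewrite ger0_norm; last by rewrite ln_ge0//; lra.
    by apply: le_lt_trans sI; apply: le_ln1Dx; lra.
  rewrite transfer//; congr (ln (fine _)); apply: eq_integral => w _.
  by rewrite mulrA [s * t]mulrC.
have := cumulant_coef_relation rI0 rm0 ht s00 cI cm rel k.
rewrite factM_cumulant_coef// => ->.
rewrite -(big_mkord xpredT (fun j => (stirling1 k j)%:~R * (j`!%:R * cumulant_coef kI j))).
(* The term j = 0 drops out because the constant coefficient is set to 0. *)
rewrite big_ltn// [cumulant_coef kI 0]/= !mulr0 add0r.
rewrite big_nat [RHS]big_nat; apply: eq_bigr => j /andP[j0 _].
by rewrite factM_cumulant_coef.
Qed.
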